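(* Let $\Delta=\{z\in\mathbb{C}:|z|\le 1\}$ and $\Gamma=\{z\in\mathbb{C}:|z|=1\}$. Let $\varphi$ be a continuous complex-valued function on $\Delta$ whose restriction to $\Gamma$ is real analytic (i.e. $\theta\mapsto\varphi(e^{i\theta})$ is a real-analytic function of $\theta\in\mathbb{R}$). Let $$\mathfrak{M}=\{a+b\varphi:\ a,b\in\mathfrak{A}_0\}\subset C(\Delta).$$ Assume that for each $x\in\operatorname{int}\Delta$ there exists a constant $M_x<\infty$ such that $$|f(x)|\le M_x\cdot\sup_{\Gamma}|f|\qquad\text{for all } f\in\mathfrak{M}.$$ Then $\varphi$ is holomorphic in $\operatorname{int}\Delta$ (and hence every function in $\mathfrak{M}$ is holomorphic in $\operatorname{int}\Delta$).
   Context: $\mathfrak{A}_0$ denotes the disk algebra: the algebra of all complex-valued functions continuous on the closed unit disk $\Delta$ and holomorphic in its interior $\operatorname{int}\Delta=\{|z|<1\}$. *)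

(* Defs.v *)
From Stdlib Require Import Reals.
From Coquelicot Require Import Coquelicot.
Open Scope R_scope.

Definition cdisk (z : C) : Prop := Cmod z <= 1.
Definition odisk (z : C) : Prop := Cmod z < 1.
Definition circle (z : C) : Prop := Cmod z = 1.

Definition expi (t : R) : C := (cos t, sin t).

Definition cont_on_cdisk (f : C -> C) : Prop :=
  forall z, cdisk z -> filterlim f (within cdisk (locally z)) (locally (f z)).

Definition holo_on_odisk (f : C -> C) : Prop :=
  forall z, odisk z -> ex_derive (K := C_AbsRing) (V := C_NormedModule) f z.

Definition disk_algebra (f : C -> C) : Prop :=
  cont_on_cdisk f /\ holo_on_odisk f.

Definition real_analytic (g : R -> C) : Prop :=
  forall t0 : R, exists (a : nat -> C) (r : R), 0 < r /\
    forall t, Rabs (t - t0) < r ->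
      is_pseries (K := R_AbsRing) (V := C_R_NormedModule) a (t - t0) (g t).

(* Main.v *)
Require Import Defs.
From Stdlib Require Import Reals Lra Lia Psatz ClassicalEpsilon.
From Coquelicot Require Import Coquelicot.
Open Scope R_scope.

(** Write [phi] on the circle as [phi_+ + psi], where [phi_+] has the nonnegative
    and [psi] the negative frequencies; analyticity is only used through the rapid
    decay of the Fourier coefficients.  For fixed [x] in the open disk, the
    hypothesis says that [b -> (b (phi - phi_+) - (b psi)_+) (x)] is bounded by a
    norm of [(b psi)_-].  A Riesz representation of this functional yields a power
    series [G] on the disk with [G x = 1] and [(G psi)_- = 0].  Applying the
    hypothesis at another point [y] to the Taylor polynomials of [G] gives
    [G y (phi - phi_+) y = (G psi)_+ y] for every [y] in the disk, so that near [x]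
    the function [phi] is the sum of [phi_+] and a quotient of power series. *)

(** * Absolutely convergent complex series *)

(** The dual of a sup norm consists of measures. To stay with sequences, the sup norm on the circle
    is enlarged to the sum of the moduli of the coefficients, and that sum to the norm of a Hilbert
    space with weights [(n + 1) ^ 2]; there the representing sequence exists and grows at most
    linearly. A second obstacle is that the hypothesis speaks of one point at a time. What carries
    information from [x] to [y] is that the relations [(G psi)_- = 0] involve boundary data alone.
    They hold because multiplication by [z] shifts the coefficients [v] of a boundary function and
    turns its value [l] at [x] into [x * l - v 0], which makes the pairing with [G] cancel; once
    proved, they no longer mention [x]. The decay orders are an accounting: two powers make a series
    converge, the linear growth of [G] costs one, and summing over both indices of [(G psi)_-] costs
    two more, hence order 5 for [psi]. *)

Definition wt (q n : nat) : R := / (INR n + 1) ^ q.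

Lemma wt_pos (q n : nat) : 0 < wt q n.
Proof.
  unfold wt. apply Rinv_0_lt_compat, pow_lt. pose proof (pos_INR n). lra.
Qed.

Lemma wt_le_1 (q n : nat) : wt q n <= 1.
Proof.
  unfold wt. rewrite <- Rinv_1. apply Rinv_le_contravar; [lra|].
  apply pow_R1_Rle. pose proof (pos_INR n). lra.
Qed.

Lemma wt_add (p q n : nat) : wt (p + q) n = wt p n * wt q n.
Proof. unfold wt. now rewrite pow_add, Rinv_mult. Qed.

Lemma wt_S (q n : nat) : (INR n + 1) * wt (S q) n = wt q n.
Proof.
  unfold wt. simpl. pose proof (pos_INR n). field.
  split; [apply pow_nonzero|]; lra.
Qed.

Lemma wt_mono (p q n : nat) : (p <= q)%nat -> wt q n <= wt p n.
Proof.
  intros H. replace q with (p + (q - p))%nat by lia. rewrite wt_add.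
  pose proof (wt_pos p n). pose proof (wt_le_1 (q - p) n). nra.
Qed.

Lemma wt_anti (q n m : nat) : (n <= m)%nat -> wt q m <= wt q n.
Proof.
  intros H. unfold wt. pose proof (pos_INR n). apply Rinv_le_contravar.
  - apply pow_lt; lra.
  - apply pow_incr. apply le_INR in H. lra.
Qed.

(** Both [n] and [m] are at most [n + m]. This separates the variables of a double series, each
    index receiving part of the decay. *)
Lemma wt_split (p q n m : nat) : wt (p + q) (n + m) <= wt p n * wt q m.
Proof.
  rewrite wt_add. apply Rmult_le_compat; try (apply Rlt_le, wt_pos);
    apply wt_anti; lia.
Qed.

(** Telescoping: [/ (n + 2) ^ 2] is at most [/ (n + 1) - / (n + 2)], so the increasing partial sums
    stay below 2. *)
Lemma ex_series_wt2 : ex_series (wt 2).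
Proof.
  assert (B : forall n, sum_n (wt 2) n <= 2 - / (INR n + 1)).
  { induction n as [|n IH].
    - rewrite sum_O. unfold wt. simpl. lra.
    - rewrite sum_Sn. change (sum_n (wt 2) n + wt 2 (S n) <= 2 - / (INR (S n) + 1)).
      assert (wt 2 (S n) <= / (INR n + 1) - / (INR (S n) + 1)).
      { unfold wt. rewrite S_INR. pose proof (pos_INR n).
        assert (E : / (INR n + 1) - / (INR n + 1 + 1) - / (INR n + 1 + 1) ^ 2
                = / ((INR n + 1) * (INR n + 1 + 1) ^ 2)) by (field; lra).
        assert (0 < / ((INR n + 1) * (INR n + 1 + 1) ^ 2)).
        { apply Rinv_0_lt_compat, Rmult_lt_0_compat; [lra|]. apply pow_lt; lra. }
        lra. }
      lra. }
  destruct (ex_finite_lim_seq_incr (sum_n (wt 2)) 2) as [l Hl].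
  - intros n. rewrite sum_Sn. unfold plus; simpl. pose proof (wt_pos 2 (S n)). lra.
  - intros n. specialize (B n).
    assert (0 < / (INR n + 1)) by (apply Rinv_0_lt_compat; pose proof (pos_INR n); lra). lra.
  - exists l. exact Hl.
Qed.

Lemma ex_series_dom (a b : nat -> R) :
  (forall n, Rabs (a n) <= b n) -> ex_series b -> ex_series a.
Proof. intros H Hb. exact (ex_series_le a b H Hb). Qed.

Lemma ex_series_wt (q : nat) (K : R) : (2 <= q)%nat -> ex_series (fun n => K * wt q n).
Proof.
  intros Hq. apply (ex_series_scal_l (V := R_NormedModule) K (wt q)).
  apply (ex_series_dom _ (wt 2)); [|exact ex_series_wt2].
  intros n. rewrite Rabs_pos_eq by (apply Rlt_le, wt_pos). now apply wt_mono.
Qed.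

Lemma ex_series_scal_R (c : R) (a : nat -> R) :
  ex_series a -> ex_series (fun n => c * a n).
Proof. exact (ex_series_scal_l (V := R_NormedModule) c a). Qed.

Lemma Series_nonneg (a : nat -> R) : (forall n, 0 <= a n) -> ex_series a -> 0 <= Series a.
Proof.
  intros H Ha. rewrite <- (Rmult_0_l (Series a)), <- Series_scal_l.
  apply Series_le; [|exact Ha]. intros n. specialize (H n). nra.
Qed.

Lemma Series_ge_term (a : nat -> R) (n : nat) :
  (forall n, 0 <= a n) -> ex_series a -> a n <= Series a.
Proof.
  revert a. induction n as [|n IH]; intros a H Ha; rewrite Series_incr_1 by exact Ha.
  - assert (0 <= Series (fun k => a (S k))); [|lra].
    apply Series_nonneg; [intros; apply H|]. now apply (ex_series_incr_1 a).
  - specialize (IH (fun k => a (S k)) (fun k => H (S k))).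
    pose proof (H 0%nat). assert (a (S n) <= Series (fun k => a (S k))); [|lra].
    apply IH. now apply (ex_series_incr_1 a).
Qed.

Lemma is_lim_tail (a : nat -> R) :
  ex_series a -> is_lim_seq (fun N => Series (fun n => a (N + n)%nat)) 0.
Proof.
  intros Ha.
  apply (is_lim_seq_incr_1 (fun N => Series (fun n => a (N + n)%nat))).
  apply (is_lim_seq_ext (fun N => Series a - sum_n a N)).
  - intros N. rewrite (Series_incr_n a (S N)) by (lia || exact Ha).
    rewrite sum_n_Reals. simpl pred. ring.
  - replace (Finite 0) with (Rbar_minus (Series a) (Series a)) by (simpl; f_equal; ring).
    apply is_lim_seq_minus with (Series a) (Series a).
    + apply is_lim_seq_const.
    + exact (Series_correct a Ha).
    + unfold is_Rbar_minus, is_Rbar_plus; simpl. reflexivity.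
Qed.

(** * Complex sums, their partial sums and tails *)

Definition asum (a : nat -> C) : Prop := ex_series (fun n => Cmod (a n)).

Definition CSer (a : nat -> C) : C :=
  (Series (fun n => Re (a n)), Series (fun n => Im (a n))).

(** Covers the [N] indices below [N], whereas [sum_n] includes its last index; hence the tail in
    [CSer_split] starts at [N] itself. *)
Fixpoint psum (a : nat -> C) (N : nat) : C :=
  match N with O => 0%C | S n => (psum a n + a n)%C end.

Lemma im_le_Cmod (z : C) : Rabs (Im z) <= Cmod z.
Proof. pose proof (Rmax_Cmod z). pose proof (Rmax_r (Rabs (fst z)) (Rabs (snd z))). unfold Im. lra. Qed.

Lemma Cmod_le_Re_Im (z : C) : Cmod z <= Rabs (Re z) + Rabs (Im z).
Proof.
  replace z with (RtoC (Re z) + Ci * RtoC (Im z))%C at 1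
    by (destruct z; unfold Re, Im; apply injective_projections; simpl; ring).
  eapply Rle_trans; [apply Cmod_triangle|].
  rewrite Cmod_mult, Cmod_Ci, !Cmod_R. lra.
Qed.

Lemma asum_Re (a : nat -> C) : asum a -> ex_series (fun n => Re (a n)).
Proof. apply ex_series_dom. intros. apply re_le_Cmod. Qed.

Lemma asum_Im (a : nat -> C) : asum a -> ex_series (fun n => Im (a n)).
Proof. apply ex_series_dom. intros. apply im_le_Cmod. Qed.

Lemma asum_dom (a : nat -> C) (b : nat -> R) :
  (forall n, Cmod (a n) <= b n) -> ex_series b -> asum a.
Proof.
  intros H. apply ex_series_dom. intros n. rewrite Rabs_pos_eq; [apply H|apply Cmod_ge_0].
Qed.

Lemma asum_plus (a b : nat -> C) : asum a -> asum b -> asum (fun n => a n + b n)%C.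
Proof.
  intros Ha Hb. apply (asum_dom _ (fun n => Cmod (a n) + Cmod (b n))).
  - intros. apply Cmod_triangle.
  - exact (ex_series_plus _ _ Ha Hb).
Qed.

Lemma asum_scal (c : C) (a : nat -> C) : asum a -> asum (fun n => c * a n)%C.
Proof.
  intros Ha. apply (asum_dom _ (fun n => Cmod c * Cmod (a n))).
  - intros. rewrite Cmod_mult. lra.
  - exact (ex_series_scal_l (Cmod c) _ Ha).
Qed.

Lemma asum_incr_n (a : nat -> C) (N : nat) : asum a -> asum (fun n => a (N + n)%nat).
Proof. intros Ha. exact (proj1 (ex_series_incr_n _ N) Ha). Qed.

Lemma CSer_ext (a b : nat -> C) : (forall n, a n = b n) -> CSer a = CSer b.
Proof. intros H. unfold CSer. f_equal; apply Series_ext; intros; now rewrite H. Qed.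

Lemma CSer_plus (a b : nat -> C) :
  asum a -> asum b -> CSer (fun n => a n + b n)%C = (CSer a + CSer b)%C.
Proof.
  intros Ha Hb. unfold CSer, Cplus; simpl.
  f_equal; rewrite <- Series_plus; auto using asum_Re, asum_Im.
Qed.

Lemma CSer_scal (c : C) (a : nat -> C) :
  asum a -> CSer (fun n => c * a n)%C = (c * CSer a)%C.
Proof.
  intros Ha. unfold CSer, Cmult; simpl.
  f_equal; rewrite <- !Series_scal_l.
  - rewrite <- Series_minus; [reflexivity| |];
      apply (ex_series_scal_l (V := R_NormedModule)); auto using asum_Re, asum_Im.
  - rewrite <- Series_plus; [reflexivity| |];
      apply (ex_series_scal_l (V := R_NormedModule)); auto using asum_Re, asum_Im.
Qed.

Lemma CSer_minus (a b : nat -> C) :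
  asum a -> asum b -> CSer (fun n => a n - b n)%C = (CSer a - CSer b)%C.
Proof.
  intros Ha Hb.
  rewrite (CSer_ext _ (fun n => a n + (-1) * b n)%C) by (intros; ring).
  rewrite CSer_plus by auto using asum_scal.
  rewrite CSer_scal by auto. ring.
Qed.

(* Rotating by the conjugate of the sum reduces the bound to real parts. *)
Lemma CSer_Cmod_le (a : nat -> C) :
  asum a -> Cmod (CSer a) <= Series (fun n => Cmod (a n)).
Proof.
  intros Ha. set (s := CSer a).
  assert (H : Cmod s * Cmod s <= Cmod s * Series (fun n => Cmod (a n))).
  { replace (Cmod s * Cmod s) with (Re (Cconj s * s)).
    2:{ rewrite Cmult_comm, <- Cmod2_conj. unfold s. simpl. ring. }
    unfold s at 2. rewrite <- CSer_scal by exact Ha.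
    rewrite <- Series_scal_l. simpl.
    eapply Rle_trans; [apply Rle_abs|].
    eapply Rle_trans; [apply Series_Rabs|].
    - apply (ex_series_dom _ (fun n => Cmod (Cconj s * a n)%C)).
      + intros n. rewrite Rabs_Rabsolu. apply (re_le_Cmod (Cconj s * a n)%C).
      + now apply asum_scal.
    - apply Series_le.
      + intros n. split; [apply Rabs_pos|].
        eapply Rle_trans; [apply (re_le_Cmod (Cconj s * a n)%C)|].
        rewrite Cmod_mult, Cmod_conj. lra.
      + exact (ex_series_scal_l (Cmod s) _ Ha). }
  destruct (Rle_lt_or_eq_dec 0 (Cmod s) (Cmod_ge_0 s)) as [P|P].
  - nra.
  - rewrite <- P. apply Series_nonneg; [intros; apply Cmod_ge_0|exact Ha].
Qed.

Lemma CSer_bound (a : nat -> C) (b : nat -> R) :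
  (forall n, Cmod (a n) <= b n) -> ex_series b -> Cmod (CSer a) <= Series b.
Proof.
  intros H Hb. pose proof (asum_dom a b H Hb) as Ha.
  eapply Rle_trans; [now apply CSer_Cmod_le|].
  apply Series_le; [|exact Hb]. intros n. split; [apply Cmod_ge_0|apply H].
Qed.

Lemma CSer_incr_1 (a : nat -> C) :
  asum a -> CSer a = (a 0%nat + CSer (fun n => a (S n)))%C.
Proof.
  intros Ha. unfold CSer, Cplus; simpl.
  f_equal; rewrite Series_incr_1; auto using asum_Re, asum_Im.
Qed.

Lemma CSer_split (a : nat -> C) (N : nat) :
  asum a -> CSer a = (psum a N + CSer (fun n => a (N + n)%nat))%C.
Proof.
  intros Ha. induction N as [|N IH].
  - simpl. ring_simplify. now apply CSer_ext.
  - rewrite IH, (CSer_incr_1 (fun n => a (N + n)%nat)) by now apply asum_incr_n.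
    simpl. rewrite Nat.add_0_r, Cplus_assoc. f_equal. apply CSer_ext.
    intros n. f_equal. lia.
Qed.

(** * Sequences of polynomial decay *)

Definition decay (q : nat) (a : nat -> C) : Prop :=
  exists K, forall n, Cmod (a n) <= K * wt q n.

Lemma decay_bound_nonneg (q : nat) (a : nat -> C) (K : R) :
  (forall n, Cmod (a n) <= K * wt q n) -> 0 <= K.
Proof.
  intros H. specialize (H 0%nat). pose proof (Cmod_ge_0 (a 0%nat)). pose proof (wt_pos q 0). nra.
Qed.

Lemma decay_asum (q : nat) (a : nat -> C) : (2 <= q)%nat -> decay q a -> asum a.
Proof.
  intros Hq [K H]. apply (asum_dom _ _ H). now apply ex_series_wt.
Qed.

Lemma decay_plus (q : nat) (a b : nat -> C) :
  decay q a -> decay q b -> decay q (fun n => a n + b n)%C.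
Proof.
  intros [K H] [L G]. exists (K + L). intros n.
  eapply Rle_trans; [apply Cmod_triangle|]. specialize (H n). specialize (G n). lra.
Qed.

Lemma decay_scal (q : nat) (c : C) (a : nat -> C) :
  decay q a -> decay q (fun n => c * a n)%C.
Proof.
  intros [K H]. exists (Cmod c * K). intros n. rewrite Cmod_mult, Rmult_assoc.
  apply Rmult_le_compat_l; [apply Cmod_ge_0|apply H].
Qed.

Lemma decay_mono (p q : nat) (a : nat -> C) : (p <= q)%nat -> decay q a -> decay p a.
Proof.
  intros Hpq [K H]. exists K. intros n. eapply Rle_trans; [apply H|].
  apply Rmult_le_compat_l; [exact (decay_bound_nonneg q a K H)|now apply wt_mono].
Qed.

Lemma decay_shift (q : nat) (a : nat -> C) (N : nat) :
  decay q a -> decay q (fun n => a (n + N)%nat).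
Proof.
  intros [K H]. exists K. intros n. eapply Rle_trans; [apply H|].
  apply Rmult_le_compat_l; [now apply (decay_bound_nonneg q a)|]. apply wt_anti. lia.
Qed.

(** * Complex differentiability of power series *)

(** Since [r < 1], the past is forgotten geometrically and the solution inherits the decay of its
    source. To gain a power, [(j + 1) * e j] is seen to obey a recurrence of the same kind with
    source [r * e j + (j + 2) * sg j], which has the order of the induction hypothesis. *)
Lemma damped_decay (q : nat) (r K : R) (e sg : nat -> R) :
  0 <= r < 1 -> (forall j, 0 <= e j) ->
  (forall j, e (S j) <= r * e j + sg j) -> (forall j, sg j <= K * wt q j) ->
  exists L, forall j, e j <= L * wt q j.
Proof.
  intros Hr. revert K e sg.
  assert (G : forall K e sg, 0 <= K -> (forall j, 0 <= e j) ->
    (forall j, e (S j) <= r * e j + sg j) -> (forall j, sg j <= K * wt q j) ->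
    exists L, forall j, e j <= L * wt q j).
  { induction q as [|q IH]; intros K e sg HK He Hrec Hs.
    (* [K / (1 - r)] is the fixed point of [v -> r * v + K]. *)
    - exists (e 0%nat + K / (1 - r)).
      assert (P : 0 <= K / (1 - r)).
      { apply Rmult_le_pos; [lra|]. apply Rlt_le, Rinv_0_lt_compat. lra. }
      assert (Q : K = (1 - r) * (K / (1 - r))) by (field; lra).
      intros j. unfold wt at 1. simpl. rewrite Rinv_1, Rmult_1_r.
      induction j as [|j IHj]; [lra|].
      specialize (Hrec j). specialize (Hs j). unfold wt in Hs; simpl in Hs.
      rewrite Rinv_1, Rmult_1_r in Hs. pose proof (He 0%nat). nra.
    - destruct (IH K e sg HK He Hrec) as [K1 H1].
      { intros j. eapply Rle_trans; [apply Hs|]. apply Rmult_le_compat_l; [lra|].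
        apply wt_mono; lia. }
      assert (HK1 : 0 <= K1).
      { pose proof (H1 0%nat). pose proof (He 0%nat). pose proof (wt_pos q 0). nra. }
      destruct (IH (r * K1 + 2 * K) (fun j => (INR j + 1) * e j)
        (fun j => r * e j + (INR j + 2) * sg j)) as [L HL].
      + nra.
      + intros j. pose proof (pos_INR j). specialize (He j). nra.
      + intros j. rewrite S_INR. pose proof (pos_INR j). specialize (Hrec j). nra.
      + intros j. pose proof (pos_INR j). specialize (H1 j). specialize (Hs j).
        pose proof (wt_S q j). pose proof (wt_pos (S q) j).
        assert ((INR j + 2) * sg j <= (INR j + 2) * (K * wt (S q) j))
          by (apply Rmult_le_compat_l; lra).
        assert ((INR j + 2) * (K * wt (S q) j) <= 2 * K * ((INR j + 1) * wt (S q) j)).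
        { assert (0 <= K * wt (S q) j) by nra. nra. }
        nra.
      + exists L. intros j. pose proof (pos_INR j). specialize (HL j).
        rewrite <- (wt_S q j) in HL. apply (Rmult_le_reg_l (INR j + 1)); [lra|]. lra. }
  intros K e sg He Hrec Hs. apply (G (Rabs K) e sg); auto using Rabs_pos.
  intros j. eapply Rle_trans; [apply Hs|].
  apply Rmult_le_compat_r; [apply Rlt_le, wt_pos|apply Rle_abs].
Qed.

(** One recurrence covers both families summed later: the powers [z ^ j], with source 0, and the
    residuals, with source [- s]. The values, the derivatives [D j] and the constants [e j] of the
    quadratic remainders obey damped recurrences, each with the preceding quantity as source, so all
    three decay like [s]. *)
Lemma horner_recurrence_taylor (q : nat) (f : nat -> C -> C) (s : nat -> C) (x : C) (r : R) :
  (forall z, f 0%nat z = f 0%nat x) ->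
  (forall j z, f (S j) z = z * f j z + s j)%C -> decay q s ->
  Cmod x <= r -> r < 1 ->
  exists (D : nat -> C) (K : R), forall j,
    Cmod (f j x) <= K * wt q j /\ Cmod (D j) <= K * wt q j /\
    forall z, Cmod z <= r ->
      Cmod (f j z - f j x - D j * (z - x))%C <= K * wt q j * Cmod (z - x)%C ^ 2.
Proof.
  intros H0 HS [Ks Hs] Hx Hr.
  assert (Hr0 : 0 <= r < 1) by (pose proof (Cmod_ge_0 x); lra).
  set (D := nat_rect (fun _ => C) 0%C (fun j d => f j x + x * d)%C).
  set (e := nat_rect (fun _ => R) 0 (fun j v => r * v + Cmod (D j))).
  destruct (damped_decay q r Ks (fun j => Cmod (f j x)) (fun j => Cmod (s j)) Hr0)
    as [K1 H1]; [intros; apply Cmod_ge_0| |exact Hs|].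
  { intros j. rewrite HS. eapply Rle_trans; [apply Cmod_triangle|].
    rewrite Cmod_mult. pose proof (Cmod_ge_0 (f j x)). nra. }
  destruct (damped_decay q r K1 (fun j => Cmod (D j)) (fun j => Cmod (f j x)) Hr0)
    as [K2 H2]; [intros; apply Cmod_ge_0| |exact H1|].
  { intros j. simpl. eapply Rle_trans; [apply Cmod_triangle|].
    rewrite Cmod_mult. pose proof (Cmod_ge_0 (D j)). nra. }
  destruct (damped_decay q r K2 e (fun j => Cmod (D j)) Hr0) as [K3 H3].
  { induction j as [|j IH]; simpl; [lra|]. pose proof (Cmod_ge_0 (D j)). nra. }
  { intros j. simpl. lra. }
  { exact H2. }
  assert (E : forall j z, Cmod z <= r ->
    Cmod (f j z - f j x - D j * (z - x))%C <= e j * Cmod (z - x)%C ^ 2).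
  { intros j z Hz. induction j as [|j IH].
    - rewrite (H0 z). simpl.
      replace (f 0%nat x - f 0%nat x - 0 * (z - x))%C with (RtoC 0) by ring.
      rewrite Cmod_0. lra.
    - rewrite !HS. simpl D. simpl e.
      replace (z * f j z + s j - (x * f j x + s j) - (f j x + x * D j) * (z - x))%C
        with (z * (f j z - f j x - D j * (z - x)) + D j * (z - x) ^ 2)%C by (simpl; ring).
      eapply Rle_trans; [apply Cmod_triangle|]. rewrite !Cmod_mult, Cmod_pow.
      pose proof (Cmod_ge_0 (f j z - f j x - D j * (z - x))%C).
      pose proof (Cmod_ge_0 z). nra. }
  exists D, (Rabs K1 + Rabs K2 + Rabs K3).
  intros j. pose proof (wt_pos q j). specialize (H1 j). specialize (H2 j). specialize (H3 j).
  pose proof (Rle_abs K1). pose proof (Rle_abs K2). pose proof (Rle_abs K3).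
  pose proof (Rabs_pos K1). pose proof (Rabs_pos K2). pose proof (Rabs_pos K3).
  repeat split.
  - nra.
  - nra.
  - intros z Hz. eapply Rle_trans; [now apply E|].
    apply Rmult_le_compat_r; [apply pow2_ge_0|]. nra.
Qed.

(** A quadratic remainder instead of a little-o: explicit constants can be summed over a series and
    carried through a quotient. *)
Definition qdiff (F : C -> C) (x : C) : Prop :=
  exists (D : C) (K r : R), 0 < r /\ forall z, Cmod (z - x)%C < r ->
    Cmod (F z - F x - D * (z - x))%C <= K * Cmod (z - x)%C ^ 2.

Lemma qdiff_ex_derive (F : C -> C) (x : C) :
  qdiff F x -> ex_derive (K := C_AbsRing) (V := C_NormedModule) F x.
Proof.
  intros (D & K & r & Hr & H). exists D. split.
  { apply (is_linear_scal_l (K := C_AbsRing) (V := C_NormedModule)). }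
  intros x' Hx'.
  apply (is_filter_lim_locally_unique (V := AbsRing_NormedModule C_AbsRing)) in Hx'. subst x'.
  intros eps.
  assert (Hd : 0 < Rmin r (eps / (Rabs K + 1))).
  { apply Rmin_glb_lt; [exact Hr|]. apply Rdiv_lt_0_compat; [apply cond_pos|].
    pose proof (Rabs_pos K); lra. }
  exists (mkposreal _ Hd). intros z Hz.
  assert (Hz' : Cmod (z - x)%C < Rmin r (eps / (Rabs K + 1))) by exact Hz.
  change (Cmod (F z - F x - (z - x) * D)%C <= eps * Cmod (z - x)%C).
  rewrite (Cmult_comm (z - x)).
  eapply Rle_trans; [apply H|].
  { eapply Rlt_le_trans; [exact Hz'|apply Rmin_l]. }
  pose proof (Rmin_r r (eps / (Rabs K + 1))). pose proof (Cmod_ge_0 (z - x)%C).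
  assert (Cmod (z - x)%C * (Rabs K + 1) <= eps).
  { replace (pos eps) with (eps / (Rabs K + 1) * (Rabs K + 1)).
    - apply Rmult_le_compat_r; [pose proof (Rabs_pos K); lra|lra].
    - field. pose proof (Rabs_pos K); lra. }
  pose proof (Rle_abs K). simpl. rewrite Rmult_1_r, <- Rmult_assoc.
  apply Rmult_le_compat_r; [lra|]. nra.
Qed.

Lemma qdiff_plus (F G : C -> C) (x : C) :
  qdiff F x -> qdiff G x -> qdiff (fun z => F z + G z)%C x.
Proof.
  intros (D & K & r & Hr & H) (D' & K' & r' & Hr' & H').
  exists (D + D')%C, (K + K'), (Rmin r r'). split; [now apply Rmin_glb_lt|].
  intros z Hz.
  specialize (H z (Rlt_le_trans _ _ _ Hz (Rmin_l _ _))).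
  specialize (H' z (Rlt_le_trans _ _ _ Hz (Rmin_r _ _))).
  replace (F z + G z - (F x + G x) - (D + D') * (z - x))%C
    with ((F z - F x - D * (z - x)) + (G z - G x - D' * (z - x)))%C by ring.
  eapply Rle_trans; [apply Cmod_triangle|]. lra.
Qed.

(** Regularity of [F] comes out of the identity: the remainder of [F], multiplied by [G z], is
    expressed through the remainders of [G] and [H], and [G] has modulus at least 1/2 near [x]. *)
Lemma qdiff_quotient (F G H : C -> C) (x : C) (r0 : R) :
  0 < r0 -> (forall z, Cmod (z - x)%C < r0 -> F z * G z = H z)%C ->
  G x = 1%C -> qdiff G x -> qdiff H x -> qdiff F x.
Proof.
  intros Hr0 E G1 (A & K & r & Hr & HG) (B & K' & r' & Hr' & HH).
  assert (Fx : H x = F x).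
  { rewrite <- E, G1; [ring|]. replace (x - x)%C with (RtoC 0) by ring. now rewrite Cmod_0. }
  set (k := Rabs K). set (a := Cmod A).
  assert (Hk : 0 <= k) by apply Rabs_pos. assert (Ha : 0 <= a) by apply Cmod_ge_0.
  (* The quotient rule at [x], where [G x = 1]. *)
  set (D := (B - F x * A)%C).
  (* Within [/ (2 * (a + k + 1))] of [x], the function [G] moves by at most 1/2; dividing by it
     yields the factor 2. *)
  exists D, (2 * (Rabs K' + Cmod (F x) * k + Cmod D * a + Cmod D * k)),
    (Rmin (Rmin r0 (Rmin r r')) (/ (2 * (a + k + 1)))).
  assert (P : 0 < / (2 * (a + k + 1))) by (apply Rinv_0_lt_compat; lra).
  split; [repeat apply Rmin_glb_lt; assumption|].
  intros z Hz.
  apply Rmin_Rgt in Hz. destruct Hz as [Hz Hz4].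
  apply Rmin_Rgt in Hz. destruct Hz as [Hz1 Hz].
  apply Rmin_Rgt in Hz. destruct Hz as [Hz2 Hz3].
  specialize (HG z Hz2). specialize (HH z Hz3). specialize (E z Hz1).
  rewrite Fx in HH. rewrite G1 in HG.
  set (d := (z - x)%C) in *. set (m := Cmod d) in *.
  assert (Hm : 0 <= m) by apply Cmod_ge_0.
  assert (Hm1 : m * (a + k + 1) <= 1 / 2).
  { replace (1 / 2) with (/ (2 * (a + k + 1)) * (a + k + 1)) by (field; lra).
    apply Rmult_le_compat_r; lra. }
  set (r1 := (G z - 1 - A * d)%C) in *. set (r2 := (H z - F x - B * d)%C) in *.
  assert (HG' : Cmod r1 <= k * m ^ 2).
  { eapply Rle_trans; [exact HG|]. apply Rmult_le_compat_r; [apply pow2_ge_0|apply Rle_abs]. }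
  assert (HH' : Cmod r2 <= Rabs K' * m ^ 2).
  { eapply Rle_trans; [exact HH|]. apply Rmult_le_compat_r; [apply pow2_ge_0|apply Rle_abs]. }
  assert (Gz : 1 / 2 <= Cmod (G z)).
  { assert (1 <= Cmod (G z) + Cmod (- (A * d + r1))%C).
    { rewrite <- Cmod_1. replace (RtoC 1) with (G z + - (A * d + r1))%C at 1.
      - apply Cmod_triangle.
      - unfold r1. ring. }
    rewrite Cmod_opp in H0. pose proof (Cmod_triangle (A * d) r1).
    rewrite Cmod_mult in H1. fold a m in H1.
    assert (m <= 1) by nra. nra. }
  assert (W : ((F z - F x - D * d) * G z = r2 - F x * r1 - D * A * d ^ 2 - D * d * r1)%C).
  { unfold r1, r2. rewrite <- E. unfold D. simpl. ring. }
  assert (Wm : Cmod (F z - F x - D * d)%C * Cmod (G z)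
    <= (Rabs K' + Cmod (F x) * k + Cmod D * a + Cmod D * k) * m ^ 2).
  { rewrite <- Cmod_mult, W. unfold Cminus.
    eapply Rle_trans; [apply Cmod_triangle|]. rewrite Cmod_opp.
    eapply Rle_trans; [apply Rplus_le_compat_r, Cmod_triangle|]. rewrite Cmod_opp.
    eapply Rle_trans; [apply Rplus_le_compat_r, Rplus_le_compat_r, Cmod_triangle|].
    rewrite Cmod_opp, !Cmod_mult, Cmod_pow. fold a m.
    pose proof (Cmod_ge_0 (F x)). pose proof (Cmod_ge_0 D). pose proof (Cmod_ge_0 r1).
    assert (Cmod (F x) * Cmod r1 <= Cmod (F x) * (k * m ^ 2))
      by (apply Rmult_le_compat_l; lra).
    assert (m <= 1) by nra.
    assert (Cmod D * m * Cmod r1 <= Cmod D * (k * m ^ 2)).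
    { rewrite Rmult_assoc. apply Rmult_le_compat_l; [lra|]. nra. }
    lra. }
  pose proof (Cmod_ge_0 (F z - F x - D * d)%C). nra.
Qed.

(** Termwise Taylor expansion: the linear growth of [g] takes one of the at least three powers of
    decay, and two remain to sum the values, the derivatives and the remainders. *)
Lemma qdiff_series (q : nat) (f : nat -> C -> C) (s g : nat -> C) (x : C) (B : R) :
  (forall z, f 0%nat z = f 0%nat x) ->
  (forall j z, f (S j) z = z * f j z + s j)%C -> decay (S (S (S q))) s ->
  (forall j, Cmod (g j) <= B * (INR j + 1)) -> Cmod x < 1 ->
  qdiff (fun z => CSer (fun j => g j * f j z)%C) x.
Proof.
  intros H0 HS Hs Hg Hx.
  (* Midway between [Cmod x] and 1, so that one contraction rate serves a whole neighbourhood of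
     [x]. *)
  set (r := (Cmod x + 1) / 2).
  destruct (horner_recurrence_taylor _ f s x r H0 HS Hs) as (D & K & H);
    [unfold r; lra|unfold r; lra|].
  assert (W : forall j (w : C) (k : R), Cmod w <= k * wt (S (S (S q))) j ->
    Cmod (g j * w)%C <= B * k * wt (S (S q)) j).
  { intros j w k Hw. rewrite Cmod_mult, <- (wt_S (S (S q))).
    pose proof (Cmod_ge_0 w). pose proof (Cmod_ge_0 (g j)). specialize (Hg j).
    pose proof (pos_INR j).
    apply Rle_trans with (B * (INR j + 1) * (k * wt (S (S (S q))) j)); [|lra].
    apply Rmult_le_compat; lra. }
  assert (S1 : asum (fun j => g j * f j x)%C).
  { apply (asum_dom _ _ (fun j => W j _ K (proj1 (H j)))). apply ex_series_wt; lia. }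
  assert (S2 : asum (fun j => g j * D j)%C).
  { apply (asum_dom _ _ (fun j => W j _ K (proj1 (proj2 (H j))))). apply ex_series_wt; lia. }
  exists (CSer (fun j => g j * D j)%C), (Series (fun j => B * K * wt (S (S q)) j)), (r - Cmod x).
  split; [unfold r; lra|]. intros z Hz.
  assert (Hzr : Cmod z <= r).
  { replace z with ((z - x) + x)%C by ring. eapply Rle_trans; [apply Cmod_triangle|lra]. }
  set (m := Cmod (z - x)%C) in *.
  assert (S3 : forall j, Cmod (g j * (f j z - f j x - D j * (z - x)))%C
    <= m ^ 2 * (B * K * wt (S (S q)) j)).
  { intros j. destruct (H j) as (_ & _ & H3). specialize (H3 z Hzr). fold m in H3.
    eapply Rle_trans; [apply (W j _ (K * m ^ 2))|].
    - eapply Rle_trans; [exact H3|]. lra.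
    - lra. }
  assert (S3' : ex_series (fun j => m ^ 2 * (B * K * wt (S (S q)) j))).
  { apply (ex_series_scal_R (m ^ 2) (fun j => B * K * wt (S (S q)) j)). apply ex_series_wt; lia. }
  pose proof (asum_dom _ _ S3 S3') as S3a.
  rewrite (CSer_ext (fun j => g j * f j z)%C
    (fun j => (g j * f j x + (z - x) * (g j * D j)) + g j * (f j z - f j x - D j * (z - x)))%C)
    by (intros; ring).
  rewrite CSer_plus by (auto using asum_plus, asum_scal).
  rewrite CSer_plus by (auto using asum_scal).
  rewrite CSer_scal by auto.
  replace (_ - _ - _)%C with (CSer (fun j => g j * (f j z - f j x - D j * (z - x)))%C) by ring.
  eapply Rle_trans; [apply (CSer_bound _ _ S3 S3')|].
  rewrite Series_scal_l. lra.
Qed.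

(** * Riesz representation in a weighted sequence space *)

(** The reciprocals of the weights are summable, so this norm controls the sum of the moduli. Taking
    real parts gives a real inner product, to be varied with real parameters. *)
Definition ip (v v' : nat -> C) : R :=
  Series (fun n => (INR n + 1) ^ 2 * Re (v n * Cconj (v' n))%C).

Lemma ip_term_bound (v v' : nat -> C) (n : nat) :
  Rabs ((INR n + 1) ^ 2 * Re (v n * Cconj (v' n))%C)
    <= ((INR n + 1) * Cmod (v n)) * ((INR n + 1) * Cmod (v' n)).
Proof.
  pose proof (pos_INR n). rewrite Rabs_mult, Rabs_pos_eq by (apply pow_le; lra).
  apply Rle_trans with ((INR n + 1) ^ 2 * (Cmod (v n) * Cmod (v' n))).
  - apply Rmult_le_compat_l; [apply pow_le; lra|].
    rewrite <- (Cmod_conj (v' n)), <- Cmod_mult. apply re_le_Cmod.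
  - apply Req_le. ring.
Qed.

Lemma decay3_scaled (v : nat -> C) (K : R) (n : nat) :
  (forall n, Cmod (v n) <= K * wt 3 n) -> (INR n + 1) * Cmod (v n) <= K * wt 2 n.
Proof.
  intros H. specialize (H n). rewrite <- (wt_S 2 n). pose proof (pos_INR n). nra.
Qed.

Lemma ex_series_ip (v v' : nat -> C) : decay 3 v -> decay 3 v' ->
  ex_series (fun n => (INR n + 1) ^ 2 * Re (v n * Cconj (v' n))%C).
Proof.
  intros [K H] [K' H']. apply (ex_series_dom _ (fun n => (K * K') * wt 2 n)).
  - intros n. eapply Rle_trans; [apply ip_term_bound|].
    pose proof (decay3_scaled v K n H). pose proof (decay3_scaled v' K' n H').
    pose proof (Cmod_ge_0 (v n)). pose proof (Cmod_ge_0 (v' n)). pose proof (pos_INR n).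
    pose proof (wt_pos 2 n). pose proof (wt_le_1 2 n).
    pose proof (decay_bound_nonneg _ _ _ H). pose proof (decay_bound_nonneg _ _ _ H').
    apply Rle_trans with ((K * wt 2 n) * (K' * wt 2 n)).
    + apply Rmult_le_compat; try assumption; apply Rmult_le_pos; lra.
    + assert (0 <= K * K') by nra. assert (wt 2 n * wt 2 n <= wt 2 n) by nra. nra.
  - apply ex_series_wt; lia.
Qed.

Lemma ip_plus_l (a b c : nat -> C) : decay 3 a -> decay 3 b -> decay 3 c ->
  ip (fun n => a n + b n)%C c = ip a c + ip b c.
Proof.
  intros. unfold ip. rewrite <- Series_plus by (now apply ex_series_ip).
  apply Series_ext. intros n. simpl. ring.
Qed.

Lemma ip_scal_l (t : R) (a c : nat -> C) : ip (fun n => t * a n)%C c = t * ip a c.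
Proof.
  unfold ip. rewrite <- Series_scal_l. apply Series_ext. intros n. simpl. ring.
Qed.

Lemma ip_sym (a b : nat -> C) : ip a b = ip b a.
Proof. apply Series_ext. intros n. simpl. ring. Qed.

Lemma Re_mult_conj (z : C) : Re (z * Cconj z)%C = Cmod z ^ 2.
Proof. rewrite <- Cmod2_conj. simpl. ring. Qed.

Lemma ip_term_le (v : nat -> C) (n : nat) :
  decay 3 v -> ((INR n + 1) * Cmod (v n)) ^ 2 <= ip v v.
Proof.
  intros H.
  eapply Rle_trans; [|apply (Series_ge_term
    (fun m => (INR m + 1) ^ 2 * Re (v m * Cconj (v m))%C) n)].
  - rewrite Re_mult_conj. apply Req_le. ring.
  - intros m. rewrite Re_mult_conj.
    apply Rmult_le_pos; apply pow2_ge_0.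
  - now apply ex_series_ip.
Qed.

Lemma ip_combination (a b : nat -> C) (t : R) : decay 3 a -> decay 3 b ->
  ip (fun n => a n + t * b n)%C (fun n => a n + t * b n)%C
    = ip a a + 2 * t * ip b a + t ^ 2 * ip b b.
Proof.
  intros Ha Hb. pose proof (decay_scal 3 t b Hb). pose proof (decay_plus 3 _ _ Ha H).
  rewrite ip_plus_l by assumption.
  rewrite (ip_sym a), (ip_sym (fun n => t * b n)%C).
  rewrite !ip_plus_l by assumption. rewrite !ip_scal_l.
  rewrite (ip_sym a (fun n => t * b n)%C), (ip_sym b (fun n => t * b n)%C).
  rewrite !ip_scal_l. ring.
Qed.

(** Plays two roles: the precision of an approximating sequence, and, at a coordinate, the inverse
    square root of the weight in [ip]. *)
Definition harmonic (i : nat) : R := / (INR i + 1).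

Lemma harmonic_pos (i : nat) : 0 < harmonic i.
Proof. apply Rinv_0_lt_compat. pose proof (pos_INR i). lra. Qed.

Lemma harmonic_lim : is_lim_seq harmonic 0.
Proof.
  apply (is_lim_seq_ext (fun n => / INR (S n))).
  - intros n. now rewrite S_INR.
  - apply (is_lim_seq_incr_1 (fun n => / INR n)).
    replace (Finite 0) with (Rbar_inv p_infty) by reflexivity.
    apply is_lim_seq_inv; [apply is_lim_seq_INR|discriminate].
Qed.

Lemma is_lim_seq_scal_0 (c : R) (a : nat -> R) :
  is_lim_seq a 0 -> is_lim_seq (fun n => c * a n) 0.
Proof.
  intros H. replace (Finite 0) with (Rbar_mult c 0) by (simpl; f_equal; ring).
  now apply is_lim_seq_scal_l.
Qed.

Lemma eq0_of_le_lim (x : R) (a : nat -> R) :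
  (forall i, Rabs x <= a i) -> is_lim_seq a 0 -> x = 0.
Proof.
  intros H Ha.
  pose proof (is_lim_seq_le (fun _ => Rabs x) a (Rabs x) 0 H (is_lim_seq_const _) Ha) as L.
  simpl in L. apply Rabs_eq_0. pose proof (Rabs_pos x). lra.
Qed.

Lemma cauchy_rate_R (a : nat -> R) (c : R) :
  (forall i j, Rabs (a i - a j) <= c * (harmonic i + harmonic j)) ->
  exists l, forall i, Rabs (a i - l) <= c * harmonic i.
Proof.
  intros H.
  assert (Hc : 0 <= c).
  { specialize (H 0%nat 0%nat). pose proof (harmonic_pos 0). pose proof (Rabs_pos (a 0%nat - a 0%nat)). nra. }
  assert (E : ex_finite_lim_seq a).
  { apply ex_lim_seq_cauchy_corr. intros eps.
    pose proof (is_lim_seq_scal_0 (2 * c) harmonic harmonic_lim) as L.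
    apply is_lim_seq_spec in L. destruct (L eps) as [N HN].
    exists N. intros n m Hn Hm.
    pose proof (HN n Hn) as An. pose proof (HN m Hm) as Am.
    rewrite Rminus_0_r in An, Am. pose proof (Rle_abs (2 * c * harmonic n)).
    pose proof (Rle_abs (2 * c * harmonic m)). specialize (H n m). lra. }
  destruct E as [l Hl]. exists l. intros i.
  assert (L1 : is_lim_seq (fun j => Rabs (a i - a j)) (Rabs (a i - l))).
  { apply (is_lim_seq_abs _ (a i - l)).
    apply is_lim_seq_minus'; [apply is_lim_seq_const|exact Hl]. }
  assert (L2 : is_lim_seq (fun j => c * harmonic i + c * harmonic j) (c * harmonic i + 0)).
  { apply is_lim_seq_plus'; [apply is_lim_seq_const|]. apply is_lim_seq_scal_0, harmonic_lim. }
  assert (L3 := is_lim_seq_le _ _ _ _ (fun j => Rle_trans _ _ _ (H i j) (Req_le _ _ (Rmult_plus_distr_l _ _ _))) L1 L2).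
  simpl in L3. lra.
Qed.

Lemma cauchy_rate_C (z : nat -> C) (c : R) :
  (forall i j, Cmod (z i - z j)%C <= c * (harmonic i + harmonic j)) ->
  exists l, forall i, Cmod (z i - l)%C <= 2 * c * harmonic i.
Proof.
  intros H.
  destruct (cauchy_rate_R (fun i => Re (z i)) c) as [x Hx].
  { intros i j. eapply Rle_trans; [apply (re_le_Cmod (z i - z j)%C)|apply H]. }
  destruct (cauchy_rate_R (fun i => Im (z i)) c) as [y Hy].
  { intros i j. eapply Rle_trans; [apply (im_le_Cmod (z i - z j)%C)|apply H]. }
  exists (x, y). intros i. eapply Rle_trans; [apply Cmod_le_Re_Im|].
  specialize (Hx i). specialize (Hy i).
  change (Re (z i - (x, y))%C) with (Re (z i) - x).
  change (Im (z i - (x, y))%C) with (Im (z i) - y). lra.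
Qed.

(* The maximiser of [2 Re l - ip v v] represents the functional; maximising
   sequences are Cauchy by the parallelogram identity. *)
Lemma weighted_riesz (T : (nat -> C) -> C -> Prop) (M : R) :
  (forall v l, T v l -> decay 3 v) ->
  (forall v l v' l', T v l -> T v' l' -> T (fun n => v n + v' n)%C (l + l')%C) ->
  (forall c v l, T v l -> T (fun n => c * v n)%C (c * l)%C) ->
  (exists v l, T v l) ->
  (forall v l, T v l -> Cmod l <= M * Series (fun n => Cmod (v n))) ->
  exists (h : nat -> C) (B : R),
    (forall n, Cmod (h n) <= B * (INR n + 1)) /\
    forall v l, T v l -> l = CSer (fun n => h n * v n)%C.
Proof.
  intros Hdec Hplus Hscal (v0 & l0 & H0) Hbd.
  set (Q := fun p : (nat -> C) * C => 2 * Re (snd p) - ip (fst p) (fst p)).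
  set (E := fun q => exists p, T (fst p) (snd p) /\ q = Q p).
  assert (HE : bound E).
  (* Termwise, [2 |M| |v n|] is at most [M ^ 2 / (n + 1) ^ 2 + (n + 1) ^ 2 |v n| ^ 2], and the first
     summand is summable. *)
  { exists (Series (fun n => Rabs M ^ 2 * wt 2 n)). intros q (p & Hp & ->). unfold Q.
    pose proof (Hdec _ _ Hp) as Hv. set (v := fst p) in *. set (l := snd p) in *.
    assert (Sv : ex_series (fun n => Cmod (v n))) by (apply (decay_asum 3); [lia|exact Hv]).
    assert (A : Re l <= Rabs M * Series (fun n => Cmod (v n))).
    { eapply Rle_trans; [apply Rle_abs|]. eapply Rle_trans; [apply re_le_Cmod|].
      eapply Rle_trans; [exact (Hbd _ _ Hp)|].
      apply Rmult_le_compat_r; [|apply Rle_abs].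
      apply Series_nonneg; [intros; apply Cmod_ge_0|exact Sv]. }
    assert (B : Series (fun n => 2 * Rabs M * Cmod (v n)) <=
      Series (fun n => Rabs M ^ 2 * wt 2 n + (INR n + 1) ^ 2 * Re (v n * Cconj (v n))%C)).
    { apply Series_le.
      - intros n. split.
        + pose proof (Rabs_pos M). pose proof (Cmod_ge_0 (v n)). nra.
        + rewrite Re_mult_conj.
          assert (W : wt 2 n = harmonic n ^ 2) by (unfold wt, harmonic; now rewrite pow_inv).
          rewrite W. pose proof (pos_INR n).
          assert (D : harmonic n * (INR n + 1) = 1) by (unfold harmonic; field; lra).
          pose proof (pow2_ge_0 (Rabs M * harmonic n - (INR n + 1) * Cmod (v n))) as P.
          assert (F : (Rabs M * harmonic n - (INR n + 1) * Cmod (v n)) ^ 2 =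
            Rabs M ^ 2 * harmonic n ^ 2 + (INR n + 1) ^ 2 * Cmod (v n) ^ 2
            - 2 * Rabs M * Cmod (v n) * (harmonic n * (INR n + 1))) by ring.
          rewrite F, D in P. lra.
      - apply (ex_series_plus (V := R_NormedModule)); [apply ex_series_wt; lia|].
        now apply ex_series_ip. }
    rewrite Series_plus in B; [|apply ex_series_wt; lia|now apply ex_series_ip].
    rewrite Series_scal_l in B. fold (ip v v) in B. lra. }
  assert (HE' : exists q, E q) by (exists (Q (v0, l0)), (v0, l0); auto).
  destruct (completeness E HE HE') as [m [Hm1 Hm2]].
  (* Precision [harmonic i ^ 2] for the values of [Q] gives precision of order [harmonic i] for the
     vectors. *)
  assert (Hch : forall i, exists p, T (fst p) (snd p) /\ m - harmonic i ^ 2 < Q p).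
  { intros i. apply NNPP. intros N.
    assert (m <= m - harmonic i ^ 2).
    { apply Hm2. intros q (p & Hp & ->).
      destruct (Rle_lt_dec (Q p) (m - harmonic i ^ 2)); [assumption|].
      exfalso. apply N. now exists p. }
    pose proof (harmonic_pos i). nra. }
  set (p := fun i => proj1_sig (constructive_indefinite_description _ (Hch i))).
  assert (Hp : forall i, T (fst (p i)) (snd (p i)) /\ m - harmonic i ^ 2 < Q (p i)).
  { intros i. exact (proj2_sig (constructive_indefinite_description _ (Hch i))). }
  clearbody p.
  assert (Hd : forall i, decay 3 (fst (p i))) by (intros i; apply (Hdec _ _ (proj1 (Hp i)))).
  assert (Hmax : forall v l, T v l -> 2 * Re l - ip v v <= m).
  { intros v l H. apply Hm1. now exists (v, l). }
  (* Approximate Euler equation: perturbing [p i] by [t] times [(v, l)], with [t] equal to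
     [harmonic i] and to [- harmonic i], bounds the first variation on both sides. *)
  assert (Hvar : forall v l i, T v l ->
    Rabs (Re l - ip v (fst (p i))) <= harmonic i * ((1 + ip v v) / 2)).
  { intros v l i H.
    assert (V : forall t : R, 2 * t * (Re l - ip v (fst (p i))) - t ^ 2 * ip v v <= harmonic i ^ 2).
    { intros t.
      pose proof (Hmax _ _ (Hplus _ _ _ _ (proj1 (Hp i)) (Hscal t _ _ H))) as G.
      cbv beta in G. rewrite ip_combination in G by eauto.
      replace (Re (snd (p i) + t * l)%C) with (Re (snd (p i)) + t * Re l) in G
        by (now rewrite <- re_scal_l).
      pose proof (proj2 (Hp i)) as G'. unfold Q in G'. lra. }
    pose proof (harmonic_pos i). pose proof (V (harmonic i)) as V1. pose proof (V (- harmonic i)) as V2.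
    apply Rabs_le. split; apply (Rmult_le_reg_l (2 * harmonic i)); try lra; nra. }
  (* The midpoint of [p i] and [p j] is admissible, so its value of [Q] is at most [m]. *)
  assert (Hcau : forall n i j, Cmod (fst (p i) n - fst (p j) n)%C <= 2 * harmonic n * (harmonic i + harmonic j)).
  { intros n i j.
    set (a := fst (p i)). set (b := fst (p j)).
    assert (Da : decay 3 a) by apply Hd. assert (Db : decay 3 b) by apply Hd.
    assert (G : ip (fun n => a n + (-1)%R * b n)%C (fun n => a n + (-1)%R * b n)%C
      <= 2 * (harmonic i ^ 2 + harmonic j ^ 2)).
    { pose proof (Hmax _ _ (Hplus _ _ _ _ (Hscal (/ 2)%R _ _ (proj1 (Hp i)))
        (Hscal (/ 2)%R _ _ (proj1 (Hp j))))) as G.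
      fold a b in G. cbv beta in G.
      rewrite (ip_combination (fun n => (/ 2)%R * a n)%C b) in G by (auto using decay_scal).
      rewrite ip_scal_l in G. rewrite (ip_sym b (fun n => (/ 2)%R * a n)%C) in G.
      rewrite (ip_sym a (fun n => (/ 2)%R * a n)%C), !ip_scal_l in G.
      replace (Re ((/ 2)%R * snd (p i) + (/ 2)%R * snd (p j))%C)
        with (/ 2 * Re (snd (p i)) + / 2 * Re (snd (p j))) in G
          by (now rewrite <- !re_scal_l).
      rewrite ip_combination by assumption. rewrite (ip_sym b a).
      pose proof (proj2 (Hp i)) as Gi. pose proof (proj2 (Hp j)) as Gj. unfold Q in Gi, Gj.
      fold a in Gi. fold b in Gj. lra. }
    pose proof (ip_term_le (fun n => a n + (-1)%R * b n)%C n
      (decay_plus _ _ _ Da (decay_scal _ _ _ Db))) as G'.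
    cbv beta in G'.
    replace (a n + (-1)%R * b n)%C with (a n - b n)%C in G' by ring.
    pose proof (harmonic_pos i). pose proof (harmonic_pos j).
    set (y := Cmod (a n - b n)%C) in *. pose proof (pos_INR n).
    assert (D : harmonic n * (INR n + 1) = 1) by (unfold harmonic; field; lra).
    assert (Y : (INR n + 1) * y <= 2 * (harmonic i + harmonic j)).
    { apply Rsqr_incr_0_var; [|lra]. unfold Rsqr. nra. }
    replace y with (harmonic n * ((INR n + 1) * y)) by (rewrite <- Rmult_assoc, D; ring).
    pose proof (harmonic_pos n). nra. }
  (* The limit is taken coordinate by coordinate, with a rate; it is not asked to lie in the domain
     of [T]. *)
  assert (HV : forall n, exists z, forall i,
    Cmod (fst (p i) n - z)%C <= 2 * (2 * harmonic n) * harmonic i).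
  { intros n. apply (cauchy_rate_C (fun i => fst (p i) n)). apply Hcau. }
  set (V := fun n => proj1_sig (constructive_indefinite_description _ (HV n))).
  assert (HV' : forall n i, Cmod (fst (p i) n - V n)%C <= 2 * (2 * harmonic n) * harmonic i).
  { intros n. exact (proj2_sig (constructive_indefinite_description _ (HV n))). }
  clearbody V. clear HV.
  (* Turns the inner product of [v] with [V] into the real part of the series of [h n * v n]. *)
  set (h := fun n => (((INR n + 1) ^ 2)%R * Cconj (V n))%C).
  assert (Hdn : forall n, (INR n + 1) * harmonic n = 1).
  { intros n. unfold harmonic. field. pose proof (pos_INR n). lra. }
  assert (Hh : exists B, forall n, Cmod (h n) <= B * (INR n + 1)).
  { destruct (Hd 0%nat) as [K HK]. exists (K + 4). intros n. unfold h.
    pose proof (pos_INR n).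
    rewrite Cmod_mult, Cmod_conj, Cmod_R, Rabs_pos_eq by (apply pow_le; lra).
    specialize (HV' n 0%nat). specialize (Hdn n).
    replace (harmonic 0) with 1 in HV' by (unfold harmonic; simpl; field).
    pose proof (decay3_scaled _ _ n HK) as G.
    assert (G1 : K * wt 2 n <= K).
    { pose proof (decay_bound_nonneg _ _ _ HK). pose proof (wt_le_1 2 n). nra. }
    assert (G2 : Cmod (V n) <= Cmod (fst (p 0%nat) n) + 2 * (2 * harmonic n) * 1).
    { replace (V n) with (fst (p 0%nat) n + - (fst (p 0%nat) n - V n))%C by ring.
      eapply Rle_trans; [apply Cmod_triangle|]. rewrite Cmod_opp. lra. }
    assert ((INR n + 1) * Cmod (V n) <= K + 4).
    { apply Rle_trans with ((INR n + 1) * (Cmod (fst (p 0%nat) n) + 2 * (2 * harmonic n) * 1)).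
      - apply Rmult_le_compat_l; lra.
      - nra. }
    simpl. rewrite Rmult_1_r. nra. }
  destruct Hh as [B HB].
  assert (Hsum : forall v, decay 3 v -> asum (fun n => h n * v n)%C).
  { intros v [K HK]. apply (asum_dom _ (fun n => B * K * wt 2 n)).
    - intros n. rewrite Cmod_mult. rewrite <- (wt_S 2 n).
      pose proof (Cmod_ge_0 (h n)). pose proof (Cmod_ge_0 (v n)). pose proof (pos_INR n).
      apply Rle_trans with (B * (INR n + 1) * (K * wt 3 n)); [|lra].
      apply Rmult_le_compat; auto.
    - apply ex_series_wt; lia. }
  assert (HRe : forall v l, T v l -> Re l = Re (CSer (fun n => h n * v n)%C)).
  { intros v l H. pose proof (Hdec _ _ H) as Dv.
    destruct (Dv) as [K HK].
    assert (S2 : ex_series (fun n => K * wt 2 n)) by (apply ex_series_wt; lia).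
    assert (X : Re l - Re (CSer (fun n => h n * v n)%C) = 0); [|lra].
    apply (eq0_of_le_lim _ (fun i => ((1 + ip v v) / 2 + 4 * Series (fun n => K * wt 2 n)) * harmonic i)).
    2:{ apply is_lim_seq_scal_0, harmonic_lim. }
    intros i.
    assert (X : Rabs (ip v (fst (p i)) - Re (CSer (fun n => h n * v n)%C))
      <= harmonic i * 4 * Series (fun n => K * wt 2 n)).
    { change (Re (CSer (fun n => h n * v n)%C)) with (Series (fun n => Re (h n * v n)%C)).
      unfold ip. rewrite <- Series_minus.
      2:{ now apply ex_series_ip. }
      2:{ apply asum_Re. now apply Hsum. }
      rewrite (Series_ext _ (fun n =>
        (INR n + 1) ^ 2 * Re (v n * Cconj (fst (p i) n - V n))%C)).
      2:{ intros n. unfold h. simpl. ring. }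
      rewrite <- Series_scal_l.
      assert (X : forall n, Rabs ((INR n + 1) ^ 2 * Re (v n * Cconj (fst (p i) n - V n))%C)
        <= harmonic i * 4 * (K * wt 2 n)).
      { intros n. eapply Rle_trans; [apply (ip_term_bound v (fun n => fst (p i) n - V n)%C n)|].
        pose proof (decay3_scaled v K n HK). specialize (HV' n i). specialize (Hdn n).
        pose proof (pos_INR n). pose proof (harmonic_pos i).
        pose proof (Cmod_ge_0 (v n)). pose proof (Cmod_ge_0 (fst (p i) n - V n)%C).
        assert ((INR n + 1) * Cmod (fst (p i) n - V n)%C <= 4 * harmonic i).
        { apply Rle_trans with ((INR n + 1) * (2 * (2 * harmonic n) * harmonic i)).
          - apply Rmult_le_compat_l; lra.
          - replace ((INR n + 1) * (2 * (2 * harmonic n) * harmonic i))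
              with (4 * harmonic i * ((INR n + 1) * harmonic n)) by ring. rewrite Hdn. lra. }
        apply Rle_trans with ((K * wt 2 n) * (4 * harmonic i)); [|lra].
        apply Rmult_le_compat; try assumption; apply Rmult_le_pos; lra. }
      assert (S3 : ex_series (fun n => harmonic i * 4 * (K * wt 2 n)))
        by now apply (ex_series_scal_R (harmonic i * 4)).
      eapply Rle_trans; [apply Series_Rabs|].
      - apply (ex_series_dom _ _ (fun n => Rle_trans _ _ _ (Req_le _ _ (Rabs_Rabsolu _)) (X n))).
        exact S3.
      - apply Series_le; [|exact S3]. intros n. split; [apply Rabs_pos|apply X]. }
    specialize (Hvar v l i H).
    replace (Re l - Re (CSer (fun n => h n * v n)%C)) with
      ((Re l - ip v (fst (p i))) + (ip v (fst (p i)) - Re (CSer (fun n => h n * v n)%C))) by ring.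
    eapply Rle_trans; [apply Rabs_triang|]. lra. }
  exists h, B. split; [exact HB|].
  intros v l H. apply injective_projections; [now apply HRe|].
  (* The real part of [- Ci * l] is the imaginary part of [l]. *)
  pose proof (HRe _ _ (Hscal (- Ci)%C _ _ H)) as G.
  rewrite (CSer_ext _ (fun n => - Ci * (h n * v n))%C) in G by (intros; ring).
  rewrite CSer_scal in G by (apply Hsum; eauto).
  simpl in G. simpl. lra.
Qed.

(** * Boundary values of the module *)

Lemma disk_algebra_const (c : C) : disk_algebra (fun _ => c).
Proof.
  split.
  - intros z _. apply filterlim_const.
  - intros z _. exists zero. apply (is_derive_const (K := C_AbsRing) (V := C_NormedModule)).
Qed.

Lemma disk_algebra_plus (f g : C -> C) :
  disk_algebra f -> disk_algebra g -> disk_algebra (fun z => f z + g z)%C.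
Proof.
  intros [Cf Hf] [Cg Hg]. split.
  - intros z Hz.
    apply (filterlim_comp_2 (G := locally (f z)) (H := locally (g z)) f g Cplus);
      [now apply Cf|now apply Cg|].
    apply (filterlim_plus (K := C_AbsRing) (V := C_NormedModule)).
  - intros z Hz. destruct (Hf z Hz) as [df Df]. destruct (Hg z Hz) as [dg Dg].
    exists (plus df dg).
    apply (is_derive_plus (K := C_AbsRing) (V := C_NormedModule) f g); assumption.
Qed.

(* The two structures carry different, equivalent uniform structures on [C], so
   that [is_linear] has to be proved anew. *)
Lemma is_derive_AbsRing_C (f : C -> C) (z l : C) :
  is_derive (K := C_AbsRing) (V := AbsRing_NormedModule C_AbsRing) f z l <->
  is_derive (K := C_AbsRing) (V := C_NormedModule) f z l.
Proof.
  split; intros [_ H]; (split; [apply is_linear_scal_l|exact H]).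
Qed.

Lemma disk_algebra_mult_id (f : C -> C) :
  disk_algebra f -> disk_algebra (fun z => z * f z)%C.
Proof.
  intros [Cf Hf]. split.
  - intros z Hz.
    apply (filterlim_comp_2 (G := locally (T := AbsRing_UniformSpace C_AbsRing) z)
      (H := locally (f z)) (fun y => y) f Cmult).
    + intros P HP. apply locally_C in HP. unfold filtermap, within.
      destruct HP as [e He]. exists e. intros y Hy _. now apply He.
    + now apply Cf.
    + apply (filterlim_scal (K := C_AbsRing) (V := C_NormedModule)).
  - intros z Hz. destruct (Hf z Hz) as [df Df].
    exists (plus (mult one (f z)) (mult z df)). apply is_derive_AbsRing_C in Df.
    apply is_derive_AbsRing_C.
    exact (is_derive_mult (K := C_AbsRing) (fun y => y) f z one df
      (is_derive_id z) Df Cmult_comm).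
Qed.

Lemma disk_algebra_scal (c : C) (f : C -> C) :
  disk_algebra f -> disk_algebra (fun z => c * f z)%C.
Proof.
  intros [Cf Hf]. split.
  - intros z Hz. eapply filterlim_comp; [now apply Cf|].
    apply (filterlim_scal_r (K := C_AbsRing) (V := C_NormedModule) c (f z)).
  - intros z Hz. destruct (Hf z Hz) as [df Df].
    exists (plus (mult zero (f z)) (mult c df)). apply is_derive_AbsRing_C in Df.
    apply is_derive_AbsRing_C.
    exact (is_derive_mult (K := C_AbsRing) (fun _ => c) f z zero df
      (is_derive_const (V := AbsRing_NormedModule C_AbsRing) c z) Df Cmult_comm).
Qed.

Lemma disk_algebra_pow (n : nat) : disk_algebra (fun z => z ^ n)%C.
Proof.
  induction n as [|n IH]; [exact (disk_algebra_const 1)|].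
  exact (disk_algebra_mult_id _ IH).
Qed.

Lemma disk_algebra_psum (p : nat -> C) (N : nat) :
  disk_algebra (fun z => psum (fun n => p n * z ^ n)%C N).
Proof.
  induction N as [|N IH]; [exact (disk_algebra_const 0)|].
  apply (disk_algebra_plus _ _ IH). apply disk_algebra_scal, disk_algebra_pow.
Qed.

(* The function with boundary values [sum_n v_n w ^ -(n + 1)] and value [l] at [x] is a
   limit, uniformly on the circle and at [x], of elements of the module. *)
Definition boundary_pair (phi : C -> C) (x : C) (v : nat -> C) (l : C) : Prop :=
  decay 3 v /\ forall eps, 0 < eps -> exists a b : C -> C,
    disk_algebra a /\ disk_algebra b /\ Cmod (a x + b x * phi x - l)%C <= eps /\
    forall w, circle w ->
      Cmod (a w + b w * phi w - CSer (fun n => v n * Cconj w ^ S n))%C <= eps.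

Lemma circle_conj (w : C) : circle w -> (w * Cconj w = 1)%C.
Proof. intros H. rewrite <- Cmod2_conj, H. now rewrite pow1. Qed.

Lemma circle_asum (q : nat) (v : nat -> C) (w : C) (k : nat -> nat) : (2 <= q)%nat ->
  decay q v -> circle w -> asum (fun n => v n * w ^ k n)%C.
Proof.
  intros Hq [K H] Hw. apply (asum_dom _ (fun n => K * wt q n)); [|now apply ex_series_wt].
  intros n. rewrite Cmod_mult, Cmod_pow, Hw, pow1, Rmult_1_r. apply H.
Qed.

Lemma circle_Cconj (w : C) : circle w -> circle (Cconj w).
Proof. unfold circle. now rewrite Cmod_conj. Qed.

Lemma boundary_pair_ext (phi : C -> C) (x : C) (v v' : nat -> C) (l l' : C) :
  (forall n, v n = v' n) -> l = l' -> boundary_pair phi x v l -> boundary_pair phi x v' l'.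
Proof.
  intros Hv <- [D H]. split.
  - destruct D as [K HK]. exists K. intros n. rewrite <- Hv. apply HK.
  - intros eps He. destruct (H eps He) as (a & b & Ha & Hb & Hx & Hw).
    exists a, b. repeat split; try apply Ha; try apply Hb; [exact Hx|].
    intros w Cw. rewrite <- (CSer_ext (fun n => v n * Cconj w ^ S n)%C).
    + now apply Hw.
    + intros n. now rewrite Hv.
Qed.

Lemma boundary_pair_plus (phi : C -> C) (x : C) (v v' : nat -> C) (l l' : C) :
  boundary_pair phi x v l -> boundary_pair phi x v' l' ->
  boundary_pair phi x (fun n => v n + v' n)%C (l + l')%C.
Proof.
  intros [D H] [D' H']. split; [now apply decay_plus|].
  intros eps He.
  destruct (H (eps / 2)) as (a & b & Ha & Hb & Hx & Hw); [lra|].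
  destruct (H' (eps / 2)) as (a' & b' & Ha' & Hb' & Hx' & Hw'); [lra|].
  exists (fun z => a z + a' z)%C, (fun z => b z + b' z)%C.
  split; [now apply disk_algebra_plus|]. split; [now apply disk_algebra_plus|].
  split.
  - replace (_ - _)%C with ((a x + b x * phi x - l) + (a' x + b' x * phi x - l'))%C by ring.
    eapply Rle_trans; [apply Cmod_triangle|]. lra.
  - intros w Cw. specialize (Hw w Cw). specialize (Hw' w Cw).
    rewrite (CSer_ext (fun n => (v n + v' n) * Cconj w ^ S n)%C
      (fun n => v n * Cconj w ^ S n + v' n * Cconj w ^ S n)%C) by (intros; ring).
    rewrite CSer_plus by (apply (circle_asum 3); auto using circle_Cconj).
    set (X := CSer (fun n => v n * Cconj w ^ S n)%C) in *.
    set (Y := CSer (fun n => v' n * Cconj w ^ S n)%C) in *.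
    replace (a w + a' w + (b w + b' w) * phi w - (X + Y))%C with
      ((a w + b w * phi w - X) + (a' w + b' w * phi w - Y))%C by ring.
    eapply Rle_trans; [apply Cmod_triangle|]. lra.
Qed.

Lemma boundary_pair_scal (phi : C -> C) (x c : C) (v : nat -> C) (l : C) :
  boundary_pair phi x v l -> boundary_pair phi x (fun n => c * v n)%C (c * l)%C.
Proof.
  intros [D H]. split; [now apply decay_scal|].
  intros eps He. pose proof (Cmod_ge_0 c) as Hc.
  assert (He' : 0 < eps / (Cmod c + 1)) by (apply Rdiv_lt_0_compat; lra).
  assert (Hm : Cmod c * (eps / (Cmod c + 1)) <= eps).
  { replace eps with ((Cmod c + 1) * (eps / (Cmod c + 1))) at 2 by (field; lra). nra. }
  destruct (H _ He') as (a & b & Ha & Hb & Hx & Hw).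
  exists (fun z => c * a z)%C, (fun z => c * b z)%C.
  split; [now apply disk_algebra_scal|]. split; [now apply disk_algebra_scal|].
  split.
  - replace (_ - _)%C with (c * (a x + b x * phi x - l))%C by ring.
    rewrite Cmod_mult. nra.
  - intros w Cw. specialize (Hw w Cw).
    rewrite (CSer_ext (fun n => c * v n * Cconj w ^ S n)%C
      (fun n => c * (v n * Cconj w ^ S n))%C) by (intros; ring).
    rewrite CSer_scal by (apply (circle_asum 3); auto using circle_Cconj).
    set (X := CSer (fun n => v n * Cconj w ^ S n)%C) in *.
    replace (c * a w + c * b w * phi w - c * X)%C with
      (c * (a w + b w * phi w - X))%C by ring.
    rewrite Cmod_mult. nra.
Qed.

Lemma boundary_pair_psum (phi : C -> C) (x : C) (g : nat -> C)
    (v : nat -> nat -> C) (l : nat -> C) (N : nat) :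
  (forall j, boundary_pair phi x (v j) (l j)) ->
  boundary_pair phi x (fun n => psum (fun j => g j * v j n)%C N)
    (psum (fun j => g j * l j)%C N).
Proof.
  intros H. induction N as [|N IH].
  - apply (boundary_pair_ext _ _ (fun n => 0 * v 0%nat n)%C _ (0 * l 0%nat)%C).
    + intros. simpl. ring.
    + simpl. ring.
    + apply boundary_pair_scal, H.
  - apply (boundary_pair_plus _ _ _ (fun n => g N * v N n)%C _ (g N * l N)%C IH).
    apply boundary_pair_scal, H.
Qed.

(** Multiplication by [z] turns [w ^ -(n + 1)] into [w ^ -n]; the constant term [v 0] that appears
    is subtracted through the component [a]. *)
Lemma boundary_pair_shift (phi : C -> C) (x : C) (v : nat -> C) (l : C) :
  odisk x -> boundary_pair phi x v l ->
  boundary_pair phi x (fun n => v (S n)) (x * l - v 0%nat)%C.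
Proof.
  intros Ox [D H]. unfold odisk in Ox. split.
  { destruct (decay_shift 3 v 1 D) as [K HK]. exists K. intros n.
    specialize (HK n). now rewrite Nat.add_1_r in HK. }
  intros eps He. destruct (H eps He) as (a & b & Ha & Hb & Hx & Hw).
  exists (fun z => z * a z + - v 0%nat)%C, (fun z => z * b z)%C.
  split; [apply disk_algebra_plus; [now apply disk_algebra_mult_id|apply disk_algebra_const]|].
  split; [now apply disk_algebra_mult_id|]. split.
  - replace (_ - _)%C with (x * (a x + b x * phi x - l))%C by ring.
    rewrite Cmod_mult. pose proof (Cmod_ge_0 (a x + b x * phi x - l)%C). nra.
  - intros w Cw. specialize (Hw w Cw).
    assert (Sw : asum (fun n => v n * Cconj w ^ S n)%C)
      by (apply (circle_asum 3); auto using circle_Cconj).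
    rewrite (CSer_incr_1 _ Sw) in Hw.
    rewrite (CSer_ext (fun n => v (S n) * Cconj w ^ S n)%C
      (fun n => w * (v (S n) * Cconj w ^ S (S n)))%C).
    2:{ intros n. pose proof (circle_conj w Cw) as E.
        replace (w * (v (S n) * Cconj w ^ S (S n)))%C
          with ((w * Cconj w) * (v (S n) * Cconj w ^ S n))%C by (simpl; ring).
        rewrite E. ring. }
    rewrite CSer_scal by exact (asum_incr_n _ 1 Sw).
    set (X := CSer (fun n => v (S n) * Cconj w ^ S (S n))%C) in *.
    replace (_ - _)%C with (w * (a w + b w * phi w - (v 0%nat * Cconj w ^ 1 + X)))%C.
    + rewrite Cmod_mult, Cw. lra.
    + pose proof (circle_conj w Cw) as E. simpl.
      replace (w * (a w + b w * phi w - (v 0%nat * (Cconj w * 1) + X)))%C with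
        (w * a w + w * b w * phi w - v 0%nat * (w * Cconj w) - w * X)%C by ring.
      rewrite E. ring.
Qed.

(** Take [b = 1] and for [a] minus a Taylor polynomial of [phi_+]. The tails of that series are
    uniformly small on the closed disk, which settles the circle and the point [x] at once. *)
Lemma boundary_pair_base (phi : C -> C) (p s : nat -> C) (x : C) :
  decay 3 p -> decay 3 s ->
  (forall w, circle w -> phi w =
    (CSer (fun n => p n * w ^ n) + CSer (fun n => s n * Cconj w ^ S n))%C) ->
  odisk x -> boundary_pair phi x s (phi x - CSer (fun n => p n * x ^ n))%C.
Proof.
  intros [K Hp] Ds Hphi Ox. split; [exact Ds|].
  assert (Sp : ex_series (fun n => K * wt 3 n)) by (apply ex_series_wt; lia).
  intros eps He. pose proof (is_lim_tail _ Sp) as L.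
  apply is_lim_seq_spec in L. destruct (L (mkposreal eps He)) as [N HN].
  specialize (HN N (le_n N)). simpl in HN.
  assert (Tail : forall z, Cmod z <= 1 ->
    Cmod (psum (fun n => p n * z ^ n) N - CSer (fun n => p n * z ^ n))%C <= eps).
  { intros z Hz.
    assert (B : forall n, Cmod (p n * z ^ n)%C <= K * wt 3 n).
    { intros n. rewrite Cmod_mult, Cmod_pow. specialize (Hp n).
      assert (Cmod z ^ n <= 1).
      { rewrite <- (pow1 n). apply pow_incr. split; [apply Cmod_ge_0|exact Hz]. }
      pose proof (Cmod_ge_0 (p n)). nra. }
    rewrite (CSer_split _ N (asum_dom _ _ B Sp)).
    set (X := psum (fun n => p n * z ^ n)%C N).
    replace (X - (X + CSer (fun n => p (N + n)%nat * z ^ (N + n))))%C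
      with (- CSer (fun n => p (N + n)%nat * z ^ (N + n)))%C by ring.
    rewrite Cmod_opp.
    eapply Rle_trans; [apply (CSer_bound _ (fun n => K * wt 3 (N + n)))|].
    - intros n. apply B.
    - exact (proj1 (ex_series_incr_n _ N) Sp).
    - apply Rabs_def2 in HN. lra. }
  exists (fun z => (-(1)) * psum (fun n => p n * z ^ n) N)%C, (fun _ => RtoC 1).
  split; [apply disk_algebra_scal, disk_algebra_psum|]. split; [apply disk_algebra_const|].
  split.
  - specialize (Tail x (Rlt_le _ _ Ox)). rewrite <- Cmod_opp in Tail.
    eapply Rle_trans; [|exact Tail]. apply Req_le. f_equal. ring.
  - intros w Cw. rewrite (Hphi w Cw). specialize (Tail w (Req_le _ _ Cw)).
    rewrite <- Cmod_opp in Tail.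
    eapply Rle_trans; [|exact Tail]. apply Req_le. f_equal. ring.
Qed.

(** The hypothesis on the module at a single point, with an arbitrary upper bound [S] on the circle
    in place of the supremum. *)
Definition dominated_at (phi : C -> C) (x : C) : Prop :=
  exists Mx : R, forall a b : C -> C, disk_algebra a -> disk_algebra b ->
    forall S : R, (forall w : C, circle w -> Cmod (a w + b w * phi w)%C <= S) ->
      Cmod (a x + b x * phi x)%C <= Mx * S.

(** Since [|w| = 1], the sum of the moduli of the coefficients bounds the boundary function, and the
    domination survives the limit. In particular [l] is determined by [v]. *)
Lemma boundary_pair_bound (phi : C -> C) (x : C) : dominated_at phi x ->
  exists M, 0 <= M /\ forall v l, boundary_pair phi x v l ->
    Cmod l <= M * Series (fun n => Cmod (v n)).
Proof.
  intros [Mx HM]. exists (Rabs Mx). split; [apply Rabs_pos|].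
  intros v l [D H]. apply le_epsilon. intros e He.
  pose proof (Rabs_pos Mx) as HP.
  assert (He' : 0 < e / (1 + Rabs Mx)) by (apply Rdiv_lt_0_compat; lra).
  set (d := e / (1 + Rabs Mx)) in *.
  assert (Hd : e = (1 + Rabs Mx) * d) by (unfold d; field; lra).
  destruct (H d He') as (a & b & Ha & Hb & Hx & Hw).
  assert (Sv : asum v) by (apply (decay_asum 3); [lia|exact D]).
  set (Sg := Series (fun n => Cmod (v n))).
  assert (HS0 : 0 <= Sg) by (apply Series_nonneg; [intros; apply Cmod_ge_0|exact Sv]).
  assert (HS : forall w, circle w -> Cmod (a w + b w * phi w)%C <= Sg + d).
  { intros w Cw. specialize (Hw w Cw).
    set (X := CSer (fun n => v n * Cconj w ^ S n)%C) in *.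
    replace (a w + b w * phi w)%C with (X + (a w + b w * phi w - X))%C by ring.
    eapply Rle_trans; [apply Cmod_triangle|]. apply Rplus_le_compat; [|exact Hw].
    apply CSer_bound; [|exact Sv]. intros n.
    rewrite Cmod_mult, Cmod_pow, (circle_Cconj w Cw), pow1. lra. }
  specialize (HM a b Ha Hb _ HS).
  replace l with ((a x + b x * phi x) - (a x + b x * phi x - l))%C by ring.
  eapply Rle_trans; [apply Cmod_triangle|]. rewrite Cmod_opp.
  pose proof (Rle_abs Mx). nra.
Qed.

(** * The annihilator and holomorphy *)

Lemma decay_pow (q : nat) (x : C) : odisk x -> decay q (fun n => x ^ n)%C.
Proof.
  intros Ox. unfold odisk in Ox.
  destruct (horner_recurrence_taylor q (fun n z => z ^ n)%C (fun _ => RtoC 0) x (Cmod x))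
    as (D & K & H); try lra.
  - reflexivity.
  - intros j z. simpl. ring.
  - exists 0. intros n. rewrite Cmod_0. lra.
  - exists K. intros n. apply H.
Qed.

Lemma decay_growth (q : nat) (g y : nat -> C) (B : R) :
  (forall j, Cmod (g j) <= B * (INR j + 1)) -> decay (S q) y ->
  decay q (fun j => g j * y j)%C.
Proof.
  intros Hg [K Hy]. exists (B * K). intros j. rewrite Cmod_mult, <- (wt_S q).
  pose proof (Cmod_ge_0 (g j)). pose proof (Cmod_ge_0 (y j)). specialize (Hg j).
  specialize (Hy j). pose proof (pos_INR j).
  apply Rle_trans with (B * (INR j + 1) * (K * wt (S q) j)); [|lra].
  apply Rmult_le_compat; lra.
Qed.

(* [c * x ^ j - (z ^ j psi)_+ (x)], where [s n] is the coefficient of [w ^ -(n + 1)]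
   in [psi]. *)
Fixpoint residual (s : nat -> C) (c x : C) (j : nat) : C :=
  match j with O => c | S j => (x * residual s c x j - s j)%C end.

(** The shift iterated [j] times: multiplication by [z ^ j] followed by removal of the nonnegative
    frequencies. *)
Lemma boundary_pair_residual (phi : C -> C) (s : nat -> C) (x c : C) (j : nat) :
  odisk x -> boundary_pair phi x s c ->
  boundary_pair phi x (fun n => s (n + j)%nat) (residual s c x j).
Proof.
  intros Ox H. induction j as [|j IH].
  - apply (boundary_pair_ext _ _ s _ c); [|reflexivity|exact H]. intros n. f_equal. lia.
  - apply (boundary_pair_ext _ _ (fun n => s (S n + j)%nat) _
      (x * residual s c x j - s (0 + j)%nat)%C).
    + intros n. f_equal. lia.
    + reflexivity.
    + exact (boundary_pair_shift _ _ (fun n => s (n + j)%nat) _ Ox IH).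
Qed.

(* Coefficients of [1 + (z - x) * sum_k h_k z ^ k]. *)
Definition annih (h : nat -> C) (x : C) (k : nat) : C :=
  match k with O => (1 - x * h O)%C | S k => (h k - x * h (S k))%C end.

Lemma annih_bound (h : nat -> C) (x : C) (B : R) : odisk x ->
  (forall n, Cmod (h n) <= B * (INR n + 1)) ->
  exists B', forall n, Cmod (annih h x n) <= B' * (INR n + 1).
Proof.
  intros Ox Hh. unfold odisk in Ox. exists (1 + 2 * B).
  assert (HB : 0 <= B).
  { specialize (Hh 0%nat). simpl in Hh. pose proof (Cmod_ge_0 (h 0%nat)). lra. }
  intros [|n]; unfold annih; (eapply Rle_trans; [apply Cmod_triangle|]);
    rewrite Cmod_opp, Cmod_mult.
  - rewrite Cmod_1. specialize (Hh 0%nat). simpl in *. pose proof (Cmod_ge_0 (h 0%nat)).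
    pose proof (Cmod_ge_0 x). nra.
  - pose proof (Hh n) as H1. pose proof (Hh (S n)) as H2. rewrite S_INR in *.
    pose proof (pos_INR n). pose proof (Cmod_ge_0 (h (S n))). pose proof (Cmod_ge_0 x). nra.
Qed.

(** Under the pairing, the factor [z - x] becomes the shift of [y] minus [x] times [y]. For
    [y k = x ^ k] the two series cancel; for the shifts of [s] they are consecutive values of the
    functional represented by [h]. *)
Lemma annih_CSer (h y : nat -> C) (x : C) (B : R) :
  odisk x -> (forall n, Cmod (h n) <= B * (INR n + 1)) -> decay 3 y ->
  CSer (fun k => annih h x k * y k)%C
    = (y 0%nat + CSer (fun k => h k * y (S k)) - x * CSer (fun k => h k * y k))%C.
Proof.
  intros Ox Hh Dy. destruct (annih_bound h x B Ox Hh) as [B' Hg].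
  assert (Dy' : decay 3 (fun k => y (S k))).
  { destruct (decay_shift 3 y 1 Dy) as [K HK]. exists K. intros n.
    specialize (HK n). now rewrite Nat.add_1_r in HK. }
  pose proof (decay_asum 2 _ (le_n 2) (decay_growth 2 _ _ _ Hg Dy)) as S1.
  pose proof (decay_asum 2 _ (le_n 2) (decay_growth 2 _ _ _ Hh Dy)) as S2.
  pose proof (decay_asum 2 _ (le_n 2) (decay_growth 2 _ _ _ Hh Dy')) as S3.
  pose proof (asum_incr_n _ 1 S2) as S4. simpl in S4.
  rewrite (CSer_incr_1 _ S1), (CSer_incr_1 _ S2).
  rewrite (CSer_ext (fun n => annih h x (S n) * y (S n))%C
    (fun n => h n * y (S n) - x * (h (S n) * y (S n)))%C) by (intros; simpl; ring).
  rewrite CSer_minus by (auto using asum_scal). rewrite CSer_scal by exact S4.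
  simpl. ring.
Qed.

(** The last series is the coefficient of [w ^ -(n + 1)] in [G psi]. The functional sends the [n]-th
    shift of [s] to [residual s c x n], so this coefficient is [s n + residual s c x (S n) - x *
    residual s c x n], which the recursion of [residual] makes zero. *)
Lemma annihilator_exists (phi : C -> C) (s : nat -> C) (x c : C) :
  odisk x -> dominated_at phi x -> boundary_pair phi x s c -> decay 3 s ->
  exists (g : nat -> C) (B : R), (forall n, Cmod (g n) <= B * (INR n + 1)) /\
    CSer (fun k => g k * x ^ k)%C = 1%C /\
    forall n, CSer (fun k => g k * s (n + k)%nat)%C = 0%C.
Proof.
  intros Ox Dx Hb Ds. destruct (boundary_pair_bound phi x Dx) as (M & _ & HM).
  destruct (weighted_riesz (boundary_pair phi x) M (fun v l H => proj1 H)
    (fun v l v' l' => boundary_pair_plus phi x v v' l l')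
    (boundary_pair_scal phi x) (ex_intro _ s (ex_intro _ c Hb)) HM) as (h & B & Hh & Hr).
  { destruct (annih_bound h x B Ox Hh) as [B' HB'].
    exists (annih h x), B'. split; [exact HB'|]. split.
    + rewrite (annih_CSer h _ x B Ox Hh) by now apply decay_pow.
      rewrite (CSer_ext (fun k => h k * x ^ S k)%C (fun k => x * (h k * x ^ k))%C)
        by (intros; simpl; ring).
      rewrite CSer_scal.
      * simpl. ring.
      * apply (decay_asum 2 _ (le_n 2)). apply (decay_growth 2 _ _ _ Hh).
        now apply decay_pow.
    + intros n.
      assert (Dn : decay 3 (fun k => s (n + k)%nat)).
      { destruct (decay_shift 3 s n Ds) as [K HK]. exists K. intros k.
        specialize (HK k). now rewrite Nat.add_comm in HK. }
      rewrite (annih_CSer h _ x B Ox Hh Dn).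
      pose proof (Hr _ _ (boundary_pair_residual phi s x c n Ox Hb)) as R0.
      pose proof (Hr _ _ (boundary_pair_residual phi s x c (S n) Ox Hb)) as R1.
      rewrite (CSer_ext (fun k => h k * s (n + k)%nat)%C
        (fun k => h k * s (k + n)%nat)%C) by (intros; now rewrite Nat.add_comm).
      rewrite (CSer_ext (fun k => h k * s (n + S k)%nat)%C
        (fun k => h k * s (k + S n)%nat)%C) by (intros; do 2 f_equal; lia).
      rewrite <- R0, <- R1. simpl. rewrite Nat.add_0_r. ring. }
Qed.

(** Separates the value [c], later [phi - phi_+] at the point, from a polynomial in [x]. *)
Lemma residual_split (s : nat -> C) (c x : C) (j : nat) :
  residual s c x j = (c * x ^ j + residual s 0 x j)%C.
Proof. induction j as [|j IH]; simpl; [|rewrite IH]; ring. Qed.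

Lemma residual_decay (q : nat) (s : nat -> C) (c x : C) :
  decay q s -> odisk x -> decay q (residual s c x).
Proof.
  intros Ds Ox. unfold odisk in Ox.
  destruct (horner_recurrence_taylor q (fun j z => residual s c z j)
    (fun n => (-1)%R * s n)%C x (Cmod x)) as (D & K & H); try lra.
  - reflexivity.
  - intros j z. simpl. ring.
  - now apply decay_scal.
  - exists K. intros n. apply H.
Qed.

(** The sequence [g] may come from a point other than [x]. Multiplying by the partial sums of [G]
    gives boundary coefficients that tend to 0 in the sum norm, because the full sums vanish;
    domination at [x] then sends the values at [x] to 0. *)
Lemma annihilator_residual (phi : C -> C) (s g : nat -> C) (x c : C) (B : R) :
  odisk x -> dominated_at phi x -> boundary_pair phi x s c -> decay 5 s ->
  (forall n, Cmod (g n) <= B * (INR n + 1)) ->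
  (forall n, CSer (fun k => g k * s (n + k)%nat)%C = 0%C) ->
  CSer (fun k => g k * residual s c x k)%C = 0%C.
Proof.
  intros Ox Dx Hb Ds Hg Han.
  destruct (boundary_pair_bound phi x Dx) as (M & HM0 & HM).
  pose proof Ds as [K HK].
  assert (HB : 0 <= B).
  { specialize (Hg 0%nat). simpl in Hg. pose proof (Cmod_ge_0 (g 0%nat)). lra. }
  pose proof (decay_bound_nonneg _ _ _ HK) as HK0.
  assert (Sgr : asum (fun k => g k * residual s c x k)%C).
  { apply (decay_asum 4); [lia|]. apply (decay_growth 4 _ _ _ Hg). now apply residual_decay. }
  (* Of the five powers two go to [n]; of the three given to [k], the growth of [g] uses one. *)
  assert (Hgs : forall n k, Cmod (g k * s (n + k)%nat)%C <= B * K * wt 2 n * wt 2 k).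
  { intros n k. rewrite Cmod_mult.
    pose proof (wt_split 2 3 n k) as W. simpl plus in W. specialize (HK (n + k)%nat).
    specialize (Hg k). pose proof (wt_S 2 k) as E.
    pose proof (Cmod_ge_0 (g k)). pose proof (Cmod_ge_0 (s (n + k)%nat)). pose proof (pos_INR k).
    apply Rle_trans with (B * (INR k + 1) * (K * (wt 2 n * wt 3 k))).
    - apply Rmult_le_compat; try assumption. eapply Rle_trans; [exact HK|].
      now apply Rmult_le_compat_l.
    - rewrite <- E. apply Req_le. ring. }
  assert (Sgs : forall n, asum (fun k => g k * s (n + k)%nat)%C).
  { intros n. apply (asum_dom _ (fun k => B * K * wt 2 n * wt 2 k)); [apply Hgs|].
    apply ex_series_wt; lia. }
  set (tail := fun N => Series (fun k => wt 2 (N + k)%nat)).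
  set (W := Series (wt 2)).
  (* A partial sum of a series with sum 0 is minus its tail. *)
  assert (Hps : forall N n, Cmod (psum (fun k => g k * s (n + k)%nat)%C N)
    <= B * K * tail N * wt 2 n).
  { intros N n. pose proof (Han n) as E. rewrite (CSer_split _ N (Sgs n)) in E.
    set (X := psum (fun k => g k * s (n + k)%nat)%C N) in *.
    set (Y := CSer (fun k => g (N + k)%nat * s (n + (N + k))%nat)%C) in *.
    replace X with (- Y)%C.
    2:{ rewrite <- (Cplus_0_l (- Y)), <- E. ring. }
    rewrite Cmod_opp.
    apply Rle_trans with (Series (fun k => B * K * wt 2 n * wt 2 (N + k))).
    - apply CSer_bound; [intros k; apply Hgs|].
      apply (ex_series_scal_R (B * K * wt 2 n)).
      exact (proj1 (ex_series_incr_n _ N) ex_series_wt2).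
    - rewrite Series_scal_l. fold (tail N). apply Req_le. ring. }
  apply Cmod_eq_0.
  apply (eq0_of_le_lim _ (fun N => M * B * K * W * tail N
    + Series (fun k => Cmod (g (N + k)%nat * residual s c x (N + k))%C))).
  2:{ replace (Finite 0) with (Finite (0 + 0)) by (f_equal; ring).
      apply is_lim_seq_plus'.
      - apply is_lim_seq_scal_0. exact (is_lim_tail _ ex_series_wt2).
      - exact (is_lim_tail _ Sgr). }
  intros N. rewrite Rabs_pos_eq by apply Cmod_ge_0.
  rewrite (CSer_split _ N Sgr).
  eapply Rle_trans; [apply Cmod_triangle|]. apply Rplus_le_compat.
  - pose proof (boundary_pair_psum phi x g _ _ N
      (fun j => boundary_pair_residual phi s x c j Ox Hb)) as P.
    specialize (HM _ _ P). cbv beta in HM.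
    eapply Rle_trans; [exact HM|].
    replace (M * B * K * W * tail N) with (M * (B * K * tail N * W)) by ring.
    apply Rmult_le_compat_l; [exact HM0|]. unfold W. rewrite <- Series_scal_l.
    apply Series_le; [|apply (ex_series_scal_R _ _ ex_series_wt2)].
    intros n. split; [apply Cmod_ge_0|apply Hps].
  - apply CSer_Cmod_le. exact (asum_incr_n _ N Sgr).
Qed.

Lemma holo_of_circle_series (phi : C -> C) (p s : nat -> C) :
  decay 3 p -> decay 5 s ->
  (forall w, circle w -> phi w =
    (CSer (fun n => p n * w ^ n) + CSer (fun n => s n * Cconj w ^ S n))%C) ->
  (forall x, odisk x -> dominated_at phi x) -> holo_on_odisk phi.
Proof.
  intros Dp Ds Hphi Hdom x Ox. apply qdiff_ex_derive.
  pose proof (decay_mono 3 5 s ltac:(lia) Ds) as Ds3.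
  set (P := fun z => CSer (fun n => p n * z ^ n)%C).
  set (phi1 := fun z => (phi z - P z)%C).
  assert (Hbase : forall z, odisk z -> boundary_pair phi z s (phi1 z)).
  { intros z Oz. now apply boundary_pair_base. }
  assert (QP : qdiff P x).
  { destruct Dp as [K HK].
    apply (qdiff_series 0 (fun n z => z ^ n)%C (fun _ => RtoC 0) p x K).
    - reflexivity.
    - intros j z. simpl. ring.
    - exists 0. intros n. rewrite Cmod_0. lra.
    - intros n. eapply Rle_trans; [apply HK|].
      pose proof (decay_bound_nonneg _ _ _ HK). pose proof (wt_le_1 3 n).
      pose proof (pos_INR n). apply Rmult_le_compat_l; lra.
    - exact Ox. }
  destruct (annihilator_exists phi s x (phi1 x) Ox (Hdom x Ox) (Hbase x Ox) Ds3)
    as (g & B & Hg & Gx & Han).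
  assert (Q1 : qdiff phi1 x).
  (* The numerator, with the sign [-1], is [(G psi)_+]; the radius [1 - Cmod x] keeps [z] in the
     open disk. *)
  { apply (qdiff_quotient phi1 (fun z => CSer (fun k => g k * z ^ k)%C)
      (fun z => CSer (fun k => ((-1)%R * g k) * residual s 0 z k)%C) x (1 - Cmod x)).
    - unfold odisk in Ox. lra.
    - intros z Hz.
      assert (Oz : odisk z).
      { unfold odisk. replace z with ((z - x) + x)%C by ring.
        eapply Rle_lt_trans; [apply Cmod_triangle|]. lra. }
      (* The relations [Han], obtained at [x], are used here at the neighbouring point [z]. *)
      pose proof (annihilator_residual phi s g z (phi1 z) B Oz (Hdom z Oz) (Hbase z Oz)
        Ds Hg Han) as E.
      rewrite (CSer_ext _ (fun k => phi1 z * (g k * z ^ k) + g k * residual s 0 z k)%C) in E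
        by (intros k; rewrite residual_split; ring).
      assert (S1 : asum (fun k => g k * z ^ k)%C).
      { apply (decay_asum 2 _ (le_n 2)). apply (decay_growth 2 _ _ _ Hg). now apply decay_pow. }
      assert (S2 : asum (fun k => g k * residual s 0 z k)%C).
      { apply (decay_asum 2 _ (le_n 2)). apply (decay_growth 2 _ _ _ Hg).
        now apply residual_decay. }
      rewrite CSer_plus, CSer_scal in E by (auto using asum_scal).
      rewrite (CSer_ext (fun k => (-1)%R * g k * residual s 0 z k)%C
        (fun k => (-1)%R * (g k * residual s 0 z k))%C) by (intros; ring).
      rewrite CSer_scal by exact S2.
      set (X := CSer (fun k => g k * z ^ k)%C) in *.
      set (Y := CSer (fun k => g k * residual s 0 z k)%C) in *.
      replace (phi1 z * X)%C with ((phi1 z * X + Y) - Y)%C by ring. rewrite E. ring.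
    - exact Gx.
    - apply (qdiff_series 0 (fun n z => z ^ n)%C (fun _ => RtoC 0) g x B).
      + reflexivity.
      + intros j z. simpl. ring.
      + exists 0. intros n. rewrite Cmod_0. lra.
      + exact Hg.
      + exact Ox.
    - apply (qdiff_series 0 (fun n z => residual s 0 z n) (fun n => (-1)%R * s n)%C _ x B).
      + reflexivity.
      + intros j z. simpl. ring.
      + now apply decay_scal.
      + intros n. rewrite Cmod_mult, Cmod_R. rewrite Rabs_left by lra.
        replace (- -1) with 1 by ring. rewrite Rmult_1_l. apply Hg.
      + exact Ox. }
  destruct (qdiff_plus _ _ _ Q1 QP) as (D & K & r & Hr & H).
  exists D, K, r. split; [exact Hr|]. intros z Hz. specialize (H z Hz). unfold phi1 in H.
  replace (phi z - P z + P z - (phi x - P x + P x))%C with (phi z - phi x)%C in H by ring.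
  exact H.
Qed.

(** * Fourier series of smooth periodic functions *)

Definition int_pi (f : R -> R) : R := RInt f (- PI) PI.

(** Restricted to the interval because the quotient by [sin (t / 2)] in Dini's argument breaks down
    at [2 * PI]. *)
Definition cont_pi (f : R -> R) : Prop := forall t, - PI <= t <= PI -> continuous f t.

Lemma cont_pi_ex_RInt (f : R -> R) : cont_pi f -> ex_RInt f (- PI) PI.
Proof.
  intros H. apply (ex_RInt_continuous (V := R_CompleteNormedModule)).
  pose proof PI_RGT_0. rewrite Rmin_left, Rmax_right by lra. exact H.
Qed.

Lemma cont_pi_plus (f g : R -> R) : cont_pi f -> cont_pi g -> cont_pi (fun t => f t + g t).
Proof. intros Hf Hg t Ht. apply (continuous_plus f g); auto. Qed.

Lemma cont_pi_mult (f g : R -> R) : cont_pi f -> cont_pi g -> cont_pi (fun t => f t * g t).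
Proof. intros Hf Hg t Ht. apply (continuous_mult f g); auto. Qed.

Lemma cont_pi_scal (c : R) (f : R -> R) : cont_pi f -> cont_pi (fun t => c * f t).
Proof. intros Hf. apply cont_pi_mult; [intros t _; apply continuous_const|exact Hf]. Qed.

Lemma continuous_cos_mul (c t : R) : continuous (fun t => cos (c * t)) t.
Proof. apply (ex_derive_continuous (fun t => cos (c * t))). auto_derive. auto. Qed.

Lemma continuous_sin_mul (c t : R) : continuous (fun t => sin (c * t)) t.
Proof. apply (ex_derive_continuous (fun t => sin (c * t))). auto_derive. auto. Qed.

Lemma int_pi_plus (f g : R -> R) : cont_pi f -> cont_pi g ->
  int_pi (fun t => f t + g t) = int_pi f + int_pi g.
Proof. intros Hf Hg. apply (RInt_plus f g); now apply cont_pi_ex_RInt. Qed.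

Lemma int_pi_scal (c : R) (f : R -> R) : cont_pi f -> int_pi (fun t => c * f t) = c * int_pi f.
Proof. intros Hf. apply (RInt_scal f); now apply cont_pi_ex_RInt. Qed.

Lemma int_pi_ext (f g : R -> R) : (forall t, - PI <= t <= PI -> f t = g t) -> int_pi f = int_pi g.
Proof.
  intros H. apply RInt_ext. intros t Ht. apply H.
  pose proof PI_RGT_0. rewrite Rmin_left, Rmax_right in Ht by lra. lra.
Qed.

Lemma sin_INR_PI (n : nat) : sin (INR n * PI) = 0.
Proof.
  induction n as [|n IH].
  - simpl. now rewrite Rmult_0_l, sin_0.
  - rewrite S_INR. replace ((INR n + 1) * PI) with (INR n * PI + PI) by ring.
    rewrite neg_sin, IH. ring.
Qed.

Lemma int_pi_cos (n : nat) : n <> 0%nat -> int_pi (fun t => cos (INR n * t)) = 0.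
Proof.
  intros Hn. assert (Hn' : INR n <> 0) by now apply not_0_INR.
  apply is_RInt_unique.
  assert (H : is_RInt (fun t => cos (INR n * t)) (- PI) PI
    (minus (sin (INR n * PI) / INR n) (sin (INR n * - PI) / INR n))).
  { apply (is_RInt_derive (fun t => sin (INR n * t) / INR n)).
    - intros t _. auto_derive; [auto|]. field. exact Hn'.
    - intros t _. apply continuous_cos_mul. }
  replace (INR n * - PI) with (- (INR n * PI)) in H by ring.
  rewrite sin_neg, sin_INR_PI in H.
  replace (minus (0 / INR n) (- 0 / INR n)) with 0 in H; [exact H|].
  unfold minus, plus, opp; simpl. field. exact Hn'.
Qed.

Lemma int_pi_const (c : R) : int_pi (fun _ => c) = 2 * PI * c.
Proof. unfold int_pi. rewrite RInt_const. unfold scal; simpl. unfold mult; simpl. ring. Qed.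

(** * Half-integer sines, Bessel's inequality and the Riemann-Lebesgue lemma *)

Definition hsin (N : nat) (t : R) : R := sin ((INR N + / 2) * t).

Lemma cont_pi_hsin (N : nat) : cont_pi (hsin N).
Proof. intros t _. apply continuous_sin_mul. Qed.

Lemma hsin_mult (N M : nat) (t : R) : (N <= M)%nat ->
  hsin N t * hsin M t = / 2 * cos (INR (M - N) * t) + - / 2 * cos (INR (M + N + 1) * t).
Proof.
  intros H. unfold hsin. rewrite minus_INR, !plus_INR by exact H. simpl (INR 1).
  set (a := (INR N + / 2) * t). set (b := (INR M + / 2) * t).
  replace ((INR M - INR N) * t) with (b - a) by (unfold a, b; ring).
  replace ((INR M + INR N + 1) * t) with (b + a) by (unfold a, b; field).
  rewrite cos_minus, cos_plus. field.
Qed.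

(** Differences and sums of half-integer frequencies are integers, so both cosines of the product
    formula integrate to 0 unless [M - N = 0]. *)
Lemma int_pi_hsin (N M : nat) : (N <= M)%nat ->
  int_pi (fun t => hsin N t * hsin M t) = if Nat.eq_dec N M then PI else 0.
Proof.
  intros H.
  rewrite (int_pi_ext _ (fun t => / 2 * cos (INR (M - N) * t) + - / 2 * cos (INR (M + N + 1) * t)))
    by (intros; now apply hsin_mult).
  rewrite int_pi_plus, !int_pi_scal by (try apply cont_pi_scal; intros t _; apply continuous_cos_mul).
  rewrite (int_pi_cos (M + N + 1)) by lia.
  destruct (Nat.eq_dec N M) as [->|D].
  - rewrite Nat.sub_diag, (int_pi_ext _ (fun _ => 1))
      by (intros; simpl; now rewrite Rmult_0_l, cos_0).
    rewrite int_pi_const. field.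
  - rewrite int_pi_cos by lia. ring.
Qed.

(** [q] minus its orthogonal projection on the first [K] half-integer sines, whose common squared
    norm is [PI]. *)
Fixpoint bessel_rem (q : R -> R) (K : nat) (t : R) : R :=
  match K with
  | O => q t
  | S K => bessel_rem q K t + - (int_pi (fun s => q s * hsin K s) / PI) * hsin K t
  end.

Lemma cont_pi_bessel_rem (q : R -> R) (K : nat) : cont_pi q -> cont_pi (bessel_rem q K).
Proof.
  intros H. induction K as [|K IH]; [exact H|].
  apply cont_pi_plus; [exact IH|]. apply cont_pi_scal, cont_pi_hsin.
Qed.

Lemma bessel_rem_coef (q : R -> R) (K M : nat) : cont_pi q -> (K <= M)%nat ->
  int_pi (fun t => bessel_rem q K t * hsin M t) = int_pi (fun t => q t * hsin M t).
Proof.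
  intros H. induction K as [|K IH]; intros HM; [reflexivity|].
  rewrite <- IH by lia. simpl.
  set (c := - (int_pi (fun s => q s * hsin K s) / PI)).
  rewrite (int_pi_ext _ (fun t => bessel_rem q K t * hsin M t + c * (hsin K t * hsin M t)))
    by (intros; ring).
  rewrite int_pi_plus, int_pi_scal, int_pi_hsin;
    try lia; try apply cont_pi_scal; try apply cont_pi_mult;
    auto using cont_pi_hsin, cont_pi_bessel_rem.
  destruct (Nat.eq_dec K M); [lia|]. ring.
Qed.

Lemma bessel_rem_sq (q : R -> R) (K : nat) : cont_pi q ->
  int_pi (fun t => bessel_rem q (S K) t * bessel_rem q (S K) t)
    = int_pi (fun t => bessel_rem q K t * bessel_rem q K t)
      - (int_pi (fun t => q t * hsin K t)) ^ 2 / PI.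
Proof.
  intros H. simpl bessel_rem.
  set (a := int_pi (fun s => q s * hsin K s)).
  rewrite (int_pi_ext _ (fun t => (bessel_rem q K t * bessel_rem q K t
    + (- (2 * a / PI)) * (bessel_rem q K t * hsin K t))
    + (a / PI) ^ 2 * (hsin K t * hsin K t)))
    by (intros; field; apply PI_neq0).
  rewrite !int_pi_plus, !int_pi_scal, int_pi_hsin, bessel_rem_coef by
    (try lia; try exact H; repeat apply cont_pi_plus; repeat apply cont_pi_scal;
     try apply cont_pi_mult; auto using cont_pi_hsin, cont_pi_bessel_rem).
  fold a. destruct (Nat.eq_dec K K); [|lia]. field. apply PI_neq0.
Qed.

(** Telescoping the Pythagorean identity of [bessel_rem_sq] gives Bessel's inequality; the squared
    coefficients are summable, hence tend to 0. *)
Lemma riemann_lebesgue (q : R -> R) : cont_pi q ->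
  is_lim_seq (fun N => int_pi (fun t => q t * hsin N t)) 0.
Proof.
  intros H. set (a := fun N => int_pi (fun t => q t * hsin N t)).
  assert (B : forall K, @eq R (sum_n (fun N => a N ^ 2) K)
    (PI * (int_pi (fun t => q t * q t)
        - int_pi (fun t => bessel_rem q (S K) t * bessel_rem q (S K) t)))).
  { pose proof PI_neq0 as P. induction K as [|K IH].
    - rewrite sum_O, bessel_rem_sq by exact H. fold (a 0%nat). simpl bessel_rem. field. exact P.
    - rewrite sum_Sn, IH, (bessel_rem_sq q (S K)) by exact H. fold (a (S K)).
      unfold plus; simpl. field. exact P. }
  assert (L : ex_series (fun N => a N ^ 2)).
  { destruct (ex_finite_lim_seq_incr (sum_n (fun N => a N ^ 2))
      (PI * int_pi (fun t => q t * q t))) as [l Hl].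
    - intros n. rewrite sum_Sn. change (sum_n (fun N => a N ^ 2) n <=
        sum_n (fun N => a N ^ 2) n + a (S n) ^ 2). pose proof (pow2_ge_0 (a (S n))). lra.
    - intros n. rewrite B. pose proof PI_RGT_0.
      apply Rmult_le_compat_l; [lra|].
      assert (0 <= int_pi (fun t => bessel_rem q (S n) t * bessel_rem q (S n) t)); [|lra].
      apply RInt_ge_0; [lra| |].
      + apply cont_pi_ex_RInt, cont_pi_mult; now apply cont_pi_bessel_rem.
      + intros t _. pose proof (pow2_ge_0 (bessel_rem q (S n) t)). nra.
    - now exists l. }
  apply ex_series_lim_0 in L.
  apply is_lim_seq_abs_0.
  apply (is_lim_seq_ext (fun N => sqrt (a N ^ 2))).
  - intros N. rewrite <- (sqrt_Rsqr_abs (a N)). unfold Rsqr. f_equal. ring.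
  - rewrite <- sqrt_0. apply (filterlim_comp _ _ _ _ sqrt _ (locally 0) _ L).
    apply (continuous_sqrt 0).
Qed.

(** The value at 0 fills the removable singularity of [F t / t] when [F 0 = 0]. *)
Definition slope (F : R -> R) (t : R) : R :=
  if Req_EM_T t 0 then Derive F 0 else F t / t.

Lemma slope_mult (F : R -> R) (t : R) : F 0 = 0 -> F t = slope F t * t.
Proof.
  intros H. unfold slope. destruct (Req_EM_T t 0) as [->|D]; [rewrite H; ring|]. field. exact D.
Qed.

Lemma continuous_slope (F : R -> R) (t : R) :
  F 0 = 0 -> ex_derive F 0 -> continuous F t -> continuous (slope F) t.
Proof.
  intros H0 HD HC. destruct (Req_EM_T t 0) as [->|D].
  - apply Derive_correct in HD. apply is_derive_Reals in HD.
    apply continuity_pt_filterlim. intros eps He.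
    destruct (HD eps He) as [d Hd]. exists d. split; [apply cond_pos|].
    intros x [[_ Hx] Hxd]. simpl in *. unfold Rdist in *. rewrite Rminus_0_r in Hxd.
    unfold slope. destruct (Req_EM_T x 0) as [->|Dx]; [now elim Hx|].
    destruct (Req_EM_T 0 0) as [_|N]; [|now elim N].
    specialize (Hd x Dx Hxd). now rewrite Rplus_0_l, H0, Rminus_0_r in Hd.
  - apply (continuous_ext_loc (slope F) (fun x => F x * / x)).
    + assert (P : 0 < Rabs t) by now apply Rabs_pos_lt.
      exists (mkposreal _ P). intros y Hy. unfold slope.
      destruct (Req_EM_T y 0) as [->|_]; [|reflexivity]. exfalso.
      change (Rabs (0 - t) < Rabs t) in Hy. rewrite Rminus_0_l, Rabs_Ropp in Hy. lra.
    + apply (continuous_mult F (fun x => / x)); [exact HC|]. now apply continuous_Rinv.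
Qed.

(** * The Dirichlet kernel *)

Fixpoint dirichlet (N : nat) (t : R) : R :=
  match N with O => 1 | S N => dirichlet N t + 2 * cos (INR (S N) * t) end.

(** Telescoping: [2 sin (t / 2) cos ((N + 1) t)] is the difference of two consecutive half-integer
    sines. *)
Lemma dirichlet_hsin (N : nat) (t : R) : sin (/ 2 * t) * dirichlet N t = hsin N t.
Proof.
  unfold hsin. induction N as [|N IH].
  - simpl. rewrite Rmult_1_r. f_equal. ring.
  - change (dirichlet (S N) t) with (dirichlet N t + 2 * cos (INR (S N) * t)).
    rewrite Rmult_plus_distr_l, IH, S_INR.
    replace ((INR N + / 2) * t) with ((INR N + 1) * t - / 2 * t) by field.
    replace ((INR N + 1 + / 2) * t) with ((INR N + 1) * t + / 2 * t) by field.
    rewrite sin_minus, sin_plus. ring.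
Qed.

Lemma continuous_dirichlet (N : nat) (c t : R) : continuous (fun t => dirichlet N (t + c)) t.
Proof.
  induction N as [|N IH]; simpl; [apply continuous_const|].
  apply (continuous_plus (fun t => dirichlet N (t + c))); [exact IH|].
  apply (ex_derive_continuous (fun t => 2 * cos (INR (S N) * (t + c)))). auto_derive. auto.
Qed.

Lemma cont_pi_dirichlet (N : nat) : cont_pi (dirichlet N).
Proof.
  intros t _. apply (continuous_ext (fun t => dirichlet N (t + 0))).
  - intros x. now rewrite Rplus_0_r.
  - apply continuous_dirichlet.
Qed.

Lemma int_pi_dirichlet (N : nat) : int_pi (dirichlet N) = 2 * PI.
Proof.
  induction N as [|N IH].
  - simpl. rewrite int_pi_const. ring.
  - change (dirichlet (S N)) with (fun t => dirichlet N t + 2 * cos (INR (S N) * t)).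
    rewrite int_pi_plus, int_pi_scal, IH; auto using cont_pi_dirichlet.
    + rewrite (int_pi_cos (S N)) by lia. ring.
    + intros t _. apply continuous_cos_mul.
    + apply cont_pi_scal. intros t _. apply continuous_cos_mul.
Qed.

Lemma int_pi_periodic (G : R -> R) (c : R) :
  (forall t, continuous G t) -> (forall t, G (t + 2 * PI) = G t) ->
  int_pi (fun t => G (t + c)) = int_pi G.
Proof.
  intros HC HP.
  assert (E : forall a b, ex_RInt G a b)
    by (intros; apply (ex_RInt_continuous (V := R_CompleteNormedModule)); auto).
  assert (Sh : forall v a b, RInt (fun t => G (t + v)) a b = RInt G (a + v) (b + v)).
  { intros v a b. rewrite <- (Rmult_1_l a), <- (Rmult_1_l b).
    rewrite <- (RInt_comp_lin G 1 v a b) by apply E. rewrite !Rmult_1_l.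
    apply RInt_ext. intros x _. rewrite (scal_one (V := R_NormedModule)).
    now rewrite Rmult_1_l. }
  unfold int_pi. rewrite Sh.
  rewrite <- (RInt_Chasles G (- PI + c) (- PI) (PI + c)) by apply E.
  rewrite <- (RInt_Chasles G (- PI) PI (PI + c)) by apply E.
  (* The piece gained beyond [PI] is the piece lost after [- PI], one period later. *)
  assert (X : RInt G PI (PI + c) = RInt G (- PI) (- PI + c)).
  { rewrite <- (RInt_ext (fun t => G (t + 2 * PI)) G (- PI) (- PI + c)) by (intros; apply HP).
    rewrite Sh. f_equal; ring. }
  rewrite X, <- (opp_RInt_swap G (- PI)) by apply E.
  unfold plus, opp; simpl. ring.
Qed.

(** * Fourier coefficients and sums of smooth periodic functions *)

Definition smooth_periodic (u : R -> R) : Prop :=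
  (forall k t, ex_derive (Derive_n u k) t) /\ forall t, u (t + 2 * PI) = u t.

Lemma smooth_periodic_Derive (u : R -> R) : smooth_periodic u -> smooth_periodic (Derive u).
Proof.
  intros [Hd Hp]. split.
  - intros k t. apply (ex_derive_ext (Derive_n u (k + 1))); [|apply Hd].
    intros x. symmetry. exact (Derive_n_comp u k 1 x).
  - intros t. pose proof (Derive_n_comp_trans u 1 t (2 * PI)) as E. simpl in E.
    etransitivity; [symmetry; exact E|]. apply Derive_ext. exact Hp.
Qed.

Lemma smooth_periodic_ex_derive (u : R -> R) (t : R) : smooth_periodic u -> ex_derive u t.
Proof. intros [Hd _]. exact (Hd 0%nat t). Qed.

Lemma smooth_periodic_continuous (u : R -> R) (t : R) : smooth_periodic u -> continuous u t.
Proof. intros H. apply (ex_derive_continuous u). now apply smooth_periodic_ex_derive. Qed.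

Lemma smooth_periodic_continuous_shift (u : R -> R) (c t : R) :
  smooth_periodic u -> continuous (fun t => u (t + c)) t.
Proof.
  intros H. apply (ex_derive_continuous (fun t => u (t + c))). auto_derive.
  now apply smooth_periodic_ex_derive.
Qed.

Lemma smooth_periodic_ends (u : R -> R) : smooth_periodic u -> u (- PI) = u PI.
Proof. intros [_ Hp]. rewrite <- Hp. f_equal. ring. Qed.

(** Left without normalisation, so that the Fourier sums tend to [2 * PI * u]; the factor enters in
    [circle_series_real]. *)
Definition cos_coef (u : R -> R) (n : nat) : R := int_pi (fun t => u t * cos (INR n * t)).
Definition sin_coef (u : R -> R) (n : nat) : R := int_pi (fun t => u t * sin (INR n * t)).

Lemma int_pi_derive (F dF : R -> R) :
  (forall t, is_derive F t (dF t)) -> (forall t, continuous dF t) -> int_pi dF = F PI - F (- PI).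
Proof.
  intros HD HC. apply is_RInt_unique.
  apply (is_RInt_derive (V := R_CompleteNormedModule) F); auto.
Qed.

Lemma cont_pi_cos_coef (u : R -> R) (n : nat) :
  smooth_periodic u -> cont_pi (fun t => u t * cos (INR n * t)).
Proof.
  intros Hu. apply cont_pi_mult; intros t _;
    [now apply smooth_periodic_continuous|apply continuous_cos_mul].
Qed.

Lemma cont_pi_sin_coef (u : R -> R) (n : nat) :
  smooth_periodic u -> cont_pi (fun t => u t * sin (INR n * t)).
Proof.
  intros Hu. apply cont_pi_mult; intros t _;
    [now apply smooth_periodic_continuous|apply continuous_sin_mul].
Qed.

(** Integration by parts; the boundary terms cancel by periodicity of [u] and evenness of the
    cosine. *)
Lemma cos_coef_Derive (u : R -> R) (n : nat) : smooth_periodic u -> cos_coef (Derive u) n = INR n * sin_coef u n.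
Proof.
  intros Hu. pose proof (smooth_periodic_Derive u Hu) as Hu'.
  assert (E : int_pi (fun t => Derive u t * cos (INR n * t) + - INR n * (u t * sin (INR n * t))) = 0).
  { rewrite (int_pi_derive (fun t => u t * cos (INR n * t))).
    - replace (INR n * - PI) with (- (INR n * PI)) by ring.
      rewrite cos_neg, smooth_periodic_ends by exact Hu. ring.
    - intros t. auto_derive; [now apply smooth_periodic_ex_derive|].
      change (Derive (fun x => u x) t) with (Derive u t). ring.
    - intros t. apply (continuous_plus (fun t => Derive u t * cos (INR n * t))).
      + apply (continuous_mult (Derive u)); [now apply smooth_periodic_continuous|].
        apply continuous_cos_mul.
      + apply (continuous_mult (fun _ => - INR n)); [apply continuous_const|].
        apply (continuous_mult u); [now apply smooth_periodic_continuous|].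
        apply continuous_sin_mul. }
  rewrite int_pi_plus, int_pi_scal in E;
    auto using cont_pi_cos_coef, cont_pi_sin_coef, cont_pi_scal.
  unfold cos_coef, sin_coef. lra.
Qed.

Lemma sin_coef_Derive (u : R -> R) (n : nat) : smooth_periodic u -> sin_coef (Derive u) n = - INR n * cos_coef u n.
Proof.
  intros Hu. pose proof (smooth_periodic_Derive u Hu) as Hu'.
  assert (E : int_pi (fun t => Derive u t * sin (INR n * t) + INR n * (u t * cos (INR n * t))) = 0).
  { rewrite (int_pi_derive (fun t => u t * sin (INR n * t))).
    - replace (INR n * - PI) with (- (INR n * PI)) by ring.
      rewrite sin_neg, sin_INR_PI. ring.
    - intros t. auto_derive; [now apply smooth_periodic_ex_derive|].
      change (Derive (fun x => u x) t) with (Derive u t). ring.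
    - intros t. apply (continuous_plus (fun t => Derive u t * sin (INR n * t))).
      + apply (continuous_mult (Derive u)); [now apply smooth_periodic_continuous|].
        apply continuous_sin_mul.
      + apply (continuous_mult (fun _ => INR n)); [apply continuous_const|].
        apply (continuous_mult u); [now apply smooth_periodic_continuous|].
        apply continuous_cos_mul. }
  rewrite int_pi_plus, int_pi_scal in E;
    auto using cont_pi_cos_coef, cont_pi_sin_coef, cont_pi_scal.
  unfold cos_coef, sin_coef. lra.
Qed.

Lemma int_pi_mult_bound (u g : R -> R) : cont_pi u -> cont_pi g -> (forall t, Rabs (g t) <= 1) ->
  Rabs (int_pi (fun t => u t * g t)) <= int_pi (fun t => Rabs (u t)).
Proof.
  intros Hu Hg Hb. pose proof PI_RGT_0.
  assert (Habs : forall f, cont_pi f -> cont_pi (fun t => Rabs (f t))).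
  { intros f Hf t Ht. apply (continuous_comp f Rabs); [now apply Hf|apply continuous_Rabs]. }
  eapply Rle_trans.
  - apply (abs_RInt_le (fun t => u t * g t)); [lra|].
    now apply cont_pi_ex_RInt, cont_pi_mult.
  - apply RInt_le; [lra| | |].
    + apply cont_pi_ex_RInt, (Habs (fun t => u t * g t)). now apply cont_pi_mult.
    + now apply cont_pi_ex_RInt, Habs.
    + intros t _. rewrite Rabs_mult. pose proof (Rabs_pos (u t)). specialize (Hb t). nra.
Qed.

(** Each derivative gains one power: [n] times a coefficient of [u] is, up to sign, a coefficient of
    [Derive u]. Adding the bound for [u] itself turns [n] into [n + 1]. *)
Lemma fourier_coef_decay (q : nat) (u : R -> R) : smooth_periodic u ->
  exists K, forall n, Rabs (cos_coef u n) <= K * wt q n /\ Rabs (sin_coef u n) <= K * wt q n.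
Proof.
  revert u. induction q as [|q IH]; intros u Hu.
  - exists (int_pi (fun t => Rabs (u t))). intros n.
    replace (wt 0 n) with 1 by (unfold wt; simpl; now rewrite Rinv_1). rewrite Rmult_1_r.
    assert (Cu : cont_pi u) by (intros t _; now apply smooth_periodic_continuous).
    split; apply int_pi_mult_bound; try exact Cu.
    + intros t _. apply continuous_cos_mul.
    + intros t. apply Rabs_le. pose proof (COS_bound (INR n * t)). lra.
    + intros t _. apply continuous_sin_mul.
    + intros t. apply Rabs_le. pose proof (SIN_bound (INR n * t)). lra.
  - destruct (IH u Hu) as [K HK].
    destruct (IH (Derive u) (smooth_periodic_Derive u Hu)) as [L HL].
    exists (K + L). intros n. destruct (HK n) as [A B]. destruct (HL n) as [A' B'].
    rewrite cos_coef_Derive, Rabs_mult in A' by exact Hu.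
    rewrite sin_coef_Derive, Rabs_mult, Rabs_Ropp in B' by exact Hu.
    pose proof (pos_INR n). rewrite Rabs_pos_eq in A', B' by exact (pos_INR n).
    split; apply (Rmult_le_reg_l (INR n + 1)); try lra;
      replace ((INR n + 1) * ((K + L) * wt (S q) n))
        with ((K + L) * ((INR n + 1) * wt (S q) n)) by ring; rewrite wt_S; lra.
Qed.

Fixpoint fourier_sum (u : R -> R) (N : nat) (t : R) : R :=
  match N with
  | O => cos_coef u 0
  | S N => fourier_sum u N t
      + 2 * (cos_coef u (S N) * cos (INR (S N) * t) + sin_coef u (S N) * sin (INR (S N) * t))
  end.

Lemma fourier_sum_dirichlet (u : R -> R) (N : nat) (t0 : R) : smooth_periodic u ->
  fourier_sum u N t0 = int_pi (fun t => u t * dirichlet N (t + - t0)).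
Proof.
  intros Hu. induction N as [|N IH].
  - apply int_pi_ext. intros t _. simpl. now rewrite Rmult_0_l, cos_0.
  - change (fourier_sum u (S N) t0) with (fourier_sum u N t0
      + 2 * (cos_coef u (S N) * cos (INR (S N) * t0) + sin_coef u (S N) * sin (INR (S N) * t0))).
    set (c := cos (INR (S N) * t0)). set (s := sin (INR (S N) * t0)).
    rewrite IH. symmetry.
    rewrite (int_pi_ext _ (fun t => u t * dirichlet N (t + - t0)
      + ((2 * c) * (u t * cos (INR (S N) * t)) + (2 * s) * (u t * sin (INR (S N) * t))))).
    2:{ intros t _. change (dirichlet (S N) (t + - t0)) with
          (dirichlet N (t + - t0) + 2 * cos (INR (S N) * (t + - t0))).
        replace (INR (S N) * (t + - t0)) with (INR (S N) * t - INR (S N) * t0) by ring.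
        rewrite cos_minus. fold c s. ring. }
    rewrite !int_pi_plus, !int_pi_scal; auto using cont_pi_cos_coef, cont_pi_sin_coef, cont_pi_scal.
    + unfold cos_coef, sin_coef. ring.
    + apply cont_pi_mult; intros t _; [now apply smooth_periodic_continuous|].
      apply continuous_dirichlet.
    + apply cont_pi_plus; auto using cont_pi_cos_coef, cont_pi_sin_coef, cont_pi_scal.
Qed.

Lemma dirichlet_periodic (N : nat) (t : R) : dirichlet N (t + 2 * PI) = dirichlet N t.
Proof.
  induction N as [|N IH]; [reflexivity|].
  change (dirichlet N (t + 2 * PI) + 2 * cos (INR (S N) * (t + 2 * PI))
    = dirichlet N t + 2 * cos (INR (S N) * t)).
  rewrite IH. do 2 f_equal.
  replace (INR (S N) * (t + 2 * PI)) with (INR (S N) * t + 2 * INR (S N) * PI) by ring.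
  apply cos_period.
Qed.

Lemma half_sine_slope_nonzero (t : R) :
  - PI <= t <= PI -> slope (fun t => sin (/ 2 * t)) t <> 0.
Proof.
  intros Ht. pose proof PI_RGT_0. unfold slope. destruct (Req_EM_T t 0) as [_|D].
  - assert (E : Derive (fun t : R => sin (/ 2 * t)) 0 = / 2).
    { apply is_derive_unique. auto_derive; [auto|]. rewrite Rmult_0_r, cos_0. field. }
    rewrite E. lra.
  - apply Rmult_integral_contrapositive_currified; [|now apply Rinv_neq_0_compat].
    destruct (Rdichotomy _ _ D).
    + assert (sin (/ 2 * t) < 0); [|lra]. apply sin_lt_0_var; lra.
    + assert (0 < sin (/ 2 * t)); [|lra]. apply sin_gt_0; lra.
Qed.

(* Dini's argument: the difference quotient of [u] against [sin (t / 2)] is continuous,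
   and the Dirichlet kernel times [sin (t / 2)] is [sin ((N + 1/2) t)]. *)
Lemma fourier_sum_lim (u : R -> R) (t0 : R) : smooth_periodic u ->
  is_lim_seq (fun N => fourier_sum u N t0) (2 * PI * u t0).
Proof.
  intros Hu.
  set (F := fun t => u (t + t0) + - u t0). set (s := fun t => sin (/ 2 * t)).
  assert (CF : forall t, continuous F t).
  { intros t. apply (continuous_plus (fun t => u (t + t0))); [|apply continuous_const].
    now apply smooth_periodic_continuous_shift. }
  assert (F0 : F 0 = 0) by (unfold F; rewrite Rplus_0_l; ring).
  assert (s0 : s 0 = 0) by (unfold s; rewrite Rmult_0_r; apply sin_0).
  assert (DF : ex_derive F 0).
  { unfold F. auto_derive. rewrite Rplus_0_l. now apply smooth_periodic_ex_derive. }
  assert (Ds : ex_derive s 0) by (unfold s; auto_derive; auto).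
  set (q := fun t => slope F t * / slope s t).
  assert (Cq : cont_pi q).
  { intros t Ht. apply (continuous_mult (slope F) (fun t => / slope s t)).
    - now apply continuous_slope.
    - apply continuous_comp.
      + apply continuous_slope; auto. apply continuous_sin_mul.
      + now apply continuous_Rinv, half_sine_slope_nonzero. }
  assert (Fq : forall t, - PI <= t <= PI -> F t = q t * s t).
  { intros t Ht. rewrite (slope_mult F t F0), (slope_mult s t s0). unfold q. field.
    now apply half_sine_slope_nonzero. }
  (* The kernel has integral [2 * PI], so the constant [u t0] can be brought under the integral;
     periodicity allows recentring at [t0]. *)
  assert (E : forall N, 2 * PI * u t0 + int_pi (fun t => q t * hsin N t) = fourier_sum u N t0).
  { intros N. rewrite fourier_sum_dirichlet by exact Hu.
    rewrite <- (int_pi_periodic (fun t => u t * dirichlet N (t + - t0)) t0).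
    - rewrite (int_pi_ext (fun t => q t * hsin N t)
        (fun t => u (t + t0) * dirichlet N t + - u t0 * dirichlet N t)).
      2:{ intros t Ht. rewrite <- dirichlet_hsin, <- Rmult_assoc.
          change (sin (/ 2 * t)) with (s t). rewrite <- Fq by exact Ht. unfold F. ring. }
      rewrite int_pi_plus, int_pi_scal, int_pi_dirichlet; auto using cont_pi_dirichlet, cont_pi_scal.
      + rewrite (int_pi_ext (fun t => u (t + t0) * dirichlet N (t + t0 + - t0))
          (fun t => u (t + t0) * dirichlet N t)); [ring|].
        intros t _. do 2 f_equal. ring.
      + apply cont_pi_mult; [|apply cont_pi_dirichlet]. intros t _.
        now apply smooth_periodic_continuous_shift.
    - intros t. apply (continuous_mult u); [now apply smooth_periodic_continuous|].
      apply continuous_dirichlet.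
    - intros t. rewrite (proj2 Hu). f_equal.
      rewrite <- (dirichlet_periodic N (t + - t0)). f_equal. ring. }
  apply (is_lim_seq_ext _ _ _ E).
  replace (Finite (2 * PI * u t0)) with (Finite (2 * PI * u t0 + 0)) by (f_equal; ring).
  apply is_lim_seq_plus'; [apply is_lim_seq_const|]. now apply riemann_lebesgue.
Qed.

(** * Real-analytic functions on the circle *)

Lemma expi_pow (t : R) (n : nat) : (expi t ^ n)%C = (cos (INR n * t), sin (INR n * t)).
Proof.
  induction n as [|n IH].
  - simpl. now rewrite Rmult_0_l, cos_0, sin_0.
  - change (expi t ^ S n)%C with (expi t * expi t ^ n)%C. rewrite IH, S_INR.
    replace ((INR n + 1) * t) with (t + INR n * t) by ring.
    rewrite cos_plus, sin_plus. unfold expi, Cmult; simpl. f_equal; ring.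
Qed.

Lemma expi_circle (t : R) : circle (expi t).
Proof.
  unfold circle, Cmod, expi; simpl. rewrite !Rmult_1_r.
  pose proof (sin2_cos2 t) as E. unfold Rsqr in E. rewrite Rplus_comm, E. apply sqrt_1.
Qed.

Lemma circle_expi (w : C) : circle w -> exists t, w = expi t.
Proof.
  intros H. destruct w as [x y]. pose proof (Cmod2_alt (x, y)) as E. rewrite H in E.
  unfold Re, Im in E; simpl in E.
  assert (Hx : -1 <= x <= 1) by nra.
  assert (Hy : sqrt (1 - x²) = Rabs y).
  { rewrite <- sqrt_Rsqr_abs. f_equal. unfold Rsqr. lra. }
  destruct (Rle_lt_dec 0 y) as [P|P].
  - exists (acos x). unfold expi. rewrite cos_acos, sin_acos, Hy, Rabs_pos_eq by assumption.
    reflexivity.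
  - exists (- acos x). unfold expi. rewrite cos_neg, sin_neg, cos_acos, sin_acos, Hy by exact Hx.
    rewrite Rabs_left by exact P. f_equal. ring.
Qed.

(** Index [n] of [s] stands for the frequency [-(n + 1)], so that the constant term belongs to [p]
    alone. *)
Definition circle_series (f : R -> C) : Prop :=
  exists p s : nat -> C, decay 5 p /\ decay 5 s /\ forall t,
    f t = (CSer (fun n => p n * expi t ^ n) + CSer (fun n => s n * Cconj (expi t) ^ S n))%C.

Lemma circle_series_asum (p s : nat -> C) (t : R) : decay 5 p -> decay 5 s ->
  asum (fun n => p n * expi t ^ n)%C /\ asum (fun n => s n * Cconj (expi t) ^ S n)%C.
Proof.
  intros Dp Ds. split.
  - apply (circle_asum 5 p _ (fun n => n)); [lia|exact Dp|apply expi_circle].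
  - apply (circle_asum 5 s _ S); [lia|exact Ds|apply circle_Cconj, expi_circle].
Qed.

Lemma circle_series_plus_scal (f g : R -> C) (c : C) : circle_series f -> circle_series g ->
  circle_series (fun t => f t + c * g t)%C.
Proof.
  intros (p & s & Dp & Ds & H) (p' & s' & Dp' & Ds' & H').
  exists (fun n => p n + c * p' n)%C, (fun n => s n + c * s' n)%C.
  split; [auto using decay_plus, decay_scal|]. split; [auto using decay_plus, decay_scal|].
  intros t. rewrite H, H'.
  destruct (circle_series_asum p s t Dp Ds) as [A1 A2].
  destruct (circle_series_asum p' s' t Dp' Ds') as [A3 A4].
  rewrite (CSer_ext (fun n => (p n + c * p' n) * expi t ^ n)%C
    (fun n => p n * expi t ^ n + c * (p' n * expi t ^ n))%C) by (intros; ring).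
  rewrite (CSer_ext (fun n => (s n + c * s' n) * Cconj (expi t) ^ S n)%C
    (fun n => s n * Cconj (expi t) ^ S n + c * (s' n * Cconj (expi t) ^ S n))%C)
    by (intros; ring).
  rewrite !CSer_plus, !CSer_scal by auto using asum_scal. ring.
Qed.

Lemma circle_series_real (u : R -> R) :
  smooth_periodic u -> circle_series (fun t => RtoC (u t)).
Proof.
  intros Hu. set (c := / (2 * PI)).
  assert (Hc : c * (2 * PI) = 1) by (unfold c; field; apply PI_neq0).
  (* The complex Fourier coefficients; as [u] is real, the one at [-(n + 1)] is the conjugate of the
     one at [n + 1]. *)
  set (p := fun n => (c * cos_coef u n, - (c * sin_coef u n)) : C).
  set (s := fun n => (c * cos_coef u (S n), c * sin_coef u (S n)) : C).
  destruct (fourier_coef_decay 5 u Hu) as [K HK].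
  assert (Dp : decay 5 p).
  { exists (Rabs c * (2 * K)). intros n. destruct (HK n) as [A B].
    eapply Rle_trans; [apply Cmod_le_Re_Im|]. unfold p, Re, Im; simpl.
    rewrite Rabs_Ropp, !Rabs_mult. pose proof (Rabs_pos c). nra. }
  assert (Ds : decay 5 s).
  { exists (Rabs c * (2 * K)). intros n. destruct (HK (S n)) as [A B].
    eapply Rle_trans; [apply Cmod_le_Re_Im|]. unfold s, Re, Im; simpl.
    rewrite !Rabs_mult. pose proof (Rabs_pos c).
    assert (HK0 : 0 <= K).
    { pose proof (Rabs_pos (cos_coef u (S n))). pose proof (wt_pos 5 (S n)). nra. }
    pose proof (wt_anti 5 n (S n) (Nat.le_succ_diag_r n)) as W.
    apply (Rmult_le_compat_l K _ _ HK0) in W.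
    rewrite <- Rmult_plus_distr_l, Rmult_assoc. apply Rmult_le_compat_l; lra. }
  exists p, s. split; [exact Dp|]. split; [exact Ds|]. intros t.
  destruct (circle_series_asum p s t Dp Ds) as [A1 A2].
  set (a := fun n => (p n * expi t ^ n)%C) in *.
  set (b := fun n => (s n * Cconj (expi t) ^ S n)%C) in *.
  (* [S N] terms of [a] and [N] terms of [b] make up the frequencies from [- N] to [N]. *)
  assert (Hab : forall N, (psum a (S N) + psum b N = RtoC (c * fourier_sum u N t))%C).
  { induction N as [|N IH].
    - simpl. unfold a, p.
      assert (B0 : sin_coef u 0 = 0).
      { unfold sin_coef. rewrite (int_pi_ext _ (fun _ => 0)), int_pi_const; [ring|].
        intros. simpl. now rewrite Rmult_0_l, sin_0, Rmult_0_r. }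
      rewrite B0. apply injective_projections; simpl; ring.
    - change (psum a (S (S N)) + psum b (S N))%C
        with (psum a (S N) + a (S N) + (psum b N + b N))%C.
      replace (psum a (S N) + a (S N) + (psum b N + b N))%C
        with ((psum a (S N) + psum b N) + (a (S N) + b N))%C by ring.
      rewrite IH. unfold a, b. rewrite <- Cpow_conj, expi_pow.
      change (fourier_sum u (S N) t) with (fourier_sum u N t
        + 2 * (cos_coef u (S N) * cos (INR (S N) * t) + sin_coef u (S N) * sin (INR (S N) * t))).
      set (C0 := cos (INR (S N) * t)). set (S0 := sin (INR (S N) * t)).
      unfold p, s. apply injective_projections; cbn -[INR cos_coef sin_coef fourier_sum]; ring. }
  assert (X : (RtoC (u t) - (CSer a + CSer b))%C = RtoC 0).
  2:{ now apply Ceq_minus. }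
  apply Cmod_eq_0.
  apply (eq0_of_le_lim _ (fun N => (c * Rabs (fourier_sum u N t - 2 * PI * u t)
    + Series (fun n => Cmod (a (S N + n)%nat))) + Series (fun n => Cmod (b (N + n)%nat)))).
  - intros N. rewrite Rabs_pos_eq by apply Cmod_ge_0.
    rewrite (CSer_split a (S N) A1), (CSer_split b N A2).
    set (Ta := CSer (fun n => a (S N + n)%nat)). set (Tb := CSer (fun n => b (N + n)%nat)).
    replace (RtoC (u t) - (psum a (S N) + Ta + (psum b N + Tb)))%C
      with ((RtoC (u t) - (psum a (S N) + psum b N)) + - Ta + - Tb)%C by ring.
    rewrite Hab.
    eapply Rle_trans; [apply Cmod_triangle|]. apply Rplus_le_compat.
    2:{ rewrite Cmod_opp. apply CSer_Cmod_le. exact (asum_incr_n _ N A2). }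
    eapply Rle_trans; [apply Cmod_triangle|]. apply Rplus_le_compat.
    2:{ rewrite Cmod_opp. apply CSer_Cmod_le. exact (asum_incr_n _ (S N) A1). }
    rewrite <- RtoC_minus, Cmod_R.
    replace (u t - c * fourier_sum u N t)
      with (- (c * (fourier_sum u N t - 2 * PI * u t))).
    + rewrite Rabs_Ropp, Rabs_mult, (Rabs_pos_eq c); [lra|].
      apply Rlt_le, Rinv_0_lt_compat. pose proof PI_RGT_0. lra.
    + replace (u t) with (c * (2 * PI) * u t) at 2 by (rewrite Hc; ring). ring.
  - replace (Finite 0) with (Finite (0 + 0 + 0)) by (f_equal; ring).
    apply is_lim_seq_plus'; [apply is_lim_seq_plus'|].
    + apply is_lim_seq_scal_0. apply -> is_lim_seq_abs_0.
      replace (Finite 0) with (Finite (2 * PI * u t - 2 * PI * u t)) by (f_equal; ring).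
      apply is_lim_seq_minus'; [now apply fourier_sum_lim|apply is_lim_seq_const].
    + apply (is_lim_seq_incr_1 (fun N => Series (fun n => Cmod (a (N + n)%nat)))).
      exact (is_lim_tail _ A1).
    + exact (is_lim_tail _ A2).
Qed.

(** * From local power series to smoothness *)

Lemma is_series_Re_Im (a : nat -> C) (l : C) :
  is_series (K := R_AbsRing) (V := C_R_NormedModule) a l ->
  is_series (fun n => Re (a n)) (Re l) /\ is_series (fun n => Im (a n)) (Im l).
Proof.
  intros H.
  assert (E1 : forall n, fst (sum_n (G := C_R_NormedModule) a n) = sum_n (fun n => Re (a n)) n).
  { induction n as [|n IH]; [now rewrite !sum_O|]. rewrite !sum_Sn, <- IH. reflexivity. }
  assert (E2 : forall n, snd (sum_n (G := C_R_NormedModule) a n) = sum_n (fun n => Im (a n)) n).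
  { induction n as [|n IH]; [now rewrite !sum_O|]. rewrite !sum_Sn, <- IH. reflexivity. }
  split.
  - apply (filterlim_ext (fun n => fst (sum_n (G := C_R_NormedModule) a n))); [exact E1|].
    eapply filterlim_comp; [exact H|]. apply (continuous_fst (U := R_UniformSpace) (V := R_UniformSpace) (fst l) (snd l)).
  - apply (filterlim_ext (fun n => snd (sum_n (G := C_R_NormedModule) a n))); [exact E2|].
    eapply filterlim_comp; [exact H|]. apply (continuous_snd (U := R_UniformSpace) (V := R_UniformSpace) (fst l) (snd l)).
Qed.

(** Convergence at distance [r / 2] makes the terms there tend to 0, so the radius of convergence is
    positive and the sum is smooth at its centre. Every point serves as the centre of its own
    series, so this suffices. *)
Lemma smooth_of_local_pseries (u : R -> R) (t0 r : R) (a : nat -> R) : 0 < r ->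
  (forall t, Rabs (t - t0) < r -> is_series (fun n => (t - t0) ^ n * a n) (u t)) ->
  forall k, ex_derive_n u k t0.
Proof.
  intros Hr H k.
  assert (HP : forall t, Rabs (t - t0) < r -> PSeries a (t + - t0) = u t).
  { intros t Ht. apply is_series_unique.
    apply (is_series_ext (fun n => (t - t0) ^ n * a n)); [|now apply H].
    intros n. apply Rmult_comm. }
  apply (ex_derive_n_ext_loc (fun t => PSeries a (t + - t0))).
  { exists (mkposreal r Hr). intros t Ht. apply HP. exact Ht. }
  apply ex_derive_n_comp_trans. apply ex_derive_n_PSeries.
  rewrite Rplus_opp_r, Rabs_R0.
  destruct (Rbar_lt_le_dec 0 (CV_radius a)) as [L|L]; [exact L|].
  exfalso. apply (CV_disk_outside a (r / 2)).
  - eapply Rbar_le_lt_trans; [exact L|]. simpl. rewrite Rabs_pos_eq; lra.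
  - apply (is_lim_seq_ext (fun n => (t0 + r / 2 - t0) ^ n * a n)).
    + intros n. replace (t0 + r / 2 - t0) with (r / 2) by ring. ring.
    + apply ex_series_lim_0. exists (u (t0 + r / 2)). apply H.
      replace (t0 + r / 2 - t0) with (r / 2) by ring. rewrite Rabs_pos_eq; lra.
Qed.

Lemma real_analytic_smooth_periodic (f : R -> C) : real_analytic f ->
  (forall t, f (t + 2 * PI) = f t) ->
  smooth_periodic (fun t => Re (f t)) /\ smooth_periodic (fun t => Im (f t)).
Proof.
  intros Ha Hp.
  assert (Hs : forall t0, exists (a : nat -> C) (r : R), 0 < r /\ forall t, Rabs (t - t0) < r ->
    is_series (fun n => (t - t0) ^ n * Re (a n)) (Re (f t)) /\
    is_series (fun n => (t - t0) ^ n * Im (a n)) (Im (f t))).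
  { intros t0. destruct (Ha t0) as (a & r & Hr & H). exists a, r. split; [exact Hr|].
    intros t Ht. specialize (H t Ht). unfold is_pseries in H.
    apply is_series_Re_Im in H. destruct H as [H1 H2].
    split; [revert H1|revert H2]; apply is_series_ext; intros n; rewrite pow_n_pow;
      reflexivity. }
  split; (split; [|intros t; now rewrite Hp]); intros k t;
    destruct (Hs t) as (a & r & Hr & H).
  - apply (smooth_of_local_pseries (fun t => Re (f t)) t r (fun n => Re (a n)) Hr
      (fun t' Ht => proj1 (H t' Ht)) (S k)).
  - apply (smooth_of_local_pseries (fun t => Im (f t)) t r (fun n => Im (a n)) Hr
      (fun t' Ht => proj2 (H t' Ht)) (S k)).
Qed.

Theorem theorem2 (phi : C -> C) :
  cont_on_cdisk phi ->
  real_analytic (fun t => phi (expi t)) ->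
  (forall x : C, odisk x ->
     exists Mx : R,
       forall a b : C -> C, disk_algebra a -> disk_algebra b ->
         forall S : R,
           (forall w : C, circle w -> Cmod (a w + b w * phi w)%C <= S) ->
           Cmod (a x + b x * phi x)%C <= Mx * S) ->
  holo_on_odisk phi.
Proof.
  intros _ Ha Hdom.
  destruct (real_analytic_smooth_periodic _ Ha) as [Hu Hv].
  { intros t. unfold expi. replace (t + 2 * PI) with (t + 2 * INR 1 * PI) by (simpl; ring).
    now rewrite cos_period, sin_period. }
  (* Real and imaginary parts are expanded separately and recombined with the factor [Ci]. *)
  destruct (circle_series_plus_scal _ _ Ci (circle_series_real _ Hu) (circle_series_real _ Hv))
    as (p & s & Dp & Ds & H).
  pose proof (decay_mono 3 5 p ltac:(lia) Dp) as Dp3.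
  apply (holo_of_circle_series phi p s Dp3 Ds); [|exact Hdom].
  intros w Cw. destruct (circle_expi w Cw) as [t ->]. rewrite <- H.
  apply injective_projections; unfold Re, Im; simpl; ring.
Qed.
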